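(* Let $G$ be a simple graph with no odd cycle of length 5 or longer, and let $\Delta$ be the maximum degree of $G$. Then $L(G)$ has a proper Galvin orientation with respect to $\Delta+1$.
   Context: A $k$-edge-colouring is an assignment of colours from $\{1,\dots,k\}$ to edges so that adjacent edges get different colours. The line graph $L(G)$ has vertex set $E(G)$, and two edges $e,f$ of $G$ are joined in $L(G)$ by as many edges as the number of ends they share in $G$; each edge of $L(G)$ corresponds to a common incidence of its two ends at a vertex of $G$. Given a partition of $V(G)$ into sets $U$ and $D$ and a $k$-edge-colouring $\varphi$ of $G$, the Galvin orientation of $L(G)$ is defined as follows: for an edge of $L(G)$ with ends $e_1,e_2$, where $\varphi(e_1)<\varphi(e_2)$, corresponding to a common incidence at a vertex $x$ of $G$: if $x\in D$ it is oriented from $e_2$ to $e_1$, and if $x\in U$ it is oriented from $e_1$ to $e_2$. A kernel of a digraph is an independent set $K$ such that every vertex outside $K$ has an out-edge into $K$; a digraph is kernel-perfect if every induced subdigraph has a kernel. The Galvin orientation is proper if it is kernel-perfect and every vertex has outdegree at most $k-1$. $L(G)$ has a proper Galvin orientation with respect to $k$ if there exist a partition $(U,D)$ of $V(G)$ and a $k$-edge-colouring $\varphi$ of $G$ whose Galvin orientation is proper. *)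

(* Defs.v *)
(* A simple graph is a symmetric irreflexive relation [e] on a
   finite type of vertices; a cycle in it is a sequence [c] with [ucycle e c],
   whose length is [size c] (meaningful for [3 <= size c]). *)
From mathcomp Require Import all_boot.

Set Implicit Arguments.
Unset Strict Implicit.
Unset Printing Implicit Defensive.

Definition degree (T : finType) (e : rel T) (x : T) : nat :=
  #|[set y | e x y]|.

Definition max_degree (T : finType) (e : rel T) : nat :=
  \max_(x : T) degree e x.

Definition edge_set (T : finType) (e : rel T) : {set {set T}} :=
  [set A : {set T} | [exists x, exists y, e x y && (A == [set x; y])]].

Definition edge (T : finType) (e : rel T) : predArgType :=
  {A : {set T} | A \in edge_set e}.

(* The edges of the line graph: [line_edge x a b] says that [a] and [b] are
   joined by an edge corresponding to their common incidence at [x], so that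
   [a] and [b] are joined by as many edges as they have common ends. *)
Definition line_edge (T : finType) (e : rel T) (x : T) (a b : edge e) : bool :=
  [&& a != b, x \in val a & x \in val b].

(* The ordered set of colours {1, ..., k} is rendered as ['I_k]. *)
Definition edge_colouring (T : finType) (e : rel T) (k : nat)
    (phi : {ffun edge e -> 'I_k}) : Prop :=
  forall (x : T) (a b : edge e), line_edge x a b -> phi a != phi b.

(* A digraph on [V], possibly with parallel arcs, is a family [arc : I -> rel V]:
   [arc i u v] says that there is an arc labelled [i] from [u] to [v].  Parallel
   arcs carry distinct labels, and are all counted by [outdegree]. *)
Definition outdegree (V I : finType) (arc : I -> rel V) (v : V) : nat :=
  #|[set p : I * V | arc p.1 v p.2]|.

(* [K] is a kernel of the subdigraph induced by [S]. *)
Definition kernel (V I : finType) (arc : I -> rel V) (S K : {set V}) : Prop :=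
  [/\ K \subset S,
      forall (i : I) (u v : V), u \in K -> v \in K -> ~~ arc i u v
    & forall u : V, u \in S :\: K ->
        exists (i : I) (v : V), v \in K /\ arc i u v].

Definition kernel_perfect (V I : finType) (arc : I -> rel V) : Prop :=
  forall S : {set V}, exists K : {set V}, kernel arc S K.

(* The arcs are labelled by the vertex at which their ends are incident: at a
   vertex of [D] they go from the larger to the smaller colour, at a vertex of
   [U] from the smaller to the larger one. *)
Definition galvin_arc (T : finType) (e : rel T) (k : nat) (U D : {set T})
    (phi : {ffun edge e -> 'I_k}) (x : T) (a b : edge e) : bool :=
  line_edge x a b &&
  ((x \in D) && (phi b < phi a) || (x \in U) && (phi a < phi b)).

Definition proper_galvin (T : finType) (e : rel T) (k : nat) (U D : {set T})
    (phi : {ffun edge e -> 'I_k}) : Prop :=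
  kernel_perfect (galvin_arc U D phi) /\
  forall a : edge e, outdegree (galvin_arc U D phi) a <= k - 1.

(* The parts of the partition may be empty. *)
Definition has_proper_galvin (T : finType) (e : rel T) (k : nat) : Prop :=
  exists (U D : {set T}) (phi : {ffun edge e -> 'I_k}),
    [/\ U :|: D = [set: T], U :&: D = set0,
        edge_colouring phi & proper_galvin U D phi].

(* Main.v *)
(* Colour the edges with {0, ..., k-1}, k = Delta + 1.  If every edge inside D
   has a colour j with 2j <= k-1 and every edge inside U one with 2j >= k-1, then
   all outdegrees are automatically at most k-1.  A kernel of a subdigraph is a
   stable matching, where a vertex of D prefers small colours and a vertex of U
   prefers large ones.  Stable matchings exist for bipartite graphs
   (Gale-Shapley), survive the addition of an edge that is the first choice of
   both its ends, and can be glued along a cut vertex.  So one may argue block by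
   block, provided that the class of a root and a list of more colours than its
   degree can be prescribed.  A block is bipartite (Koenig's theorem), a K_4, or a
   book K_{1,1,n}; the last two are coloured by hand. *)
Require Import Defs.
From mathcomp Require Import all_boot zify.

Set Implicit Arguments.
Unset Strict Implicit.
Unset Printing Implicit Defensive.

(** A graph with an odd cycle can lack a stable matching, for instance when the vertices of a
    triangle rank each other cyclically. The colourings of books and of K_4 are therefore chosen so
    that every subgraph is bipartite between D and U or has an edge that both its ends rank first.
    Lists at a root are longer than its degree for the following reason. In a book with n pages
    rooted on its spine, the root has degree n+1, while giving each page two consecutive colours
    takes n+1 colours beside that of the spine edge. The surplus of one survives a cut vertex,
    because the block coloured first uses exactly one colour per edge there, and it is available at
    the start because k exceeds the maximum degree. Replacing each colour c by k-1-c while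
    exchanging U and D reverses the order of colours and the preference rule together. Preferences
    do not change, so only roots in D need a colouring by hand. *)

(** * Stable matchings: existence and gluing at a vertex *)

Section StableMatching.

Variables (T : finType) (rk : T -> T -> nat).
Implicit Types S M : rel T.

(** Ranks are preferences: the smaller value of [rk] is preferred. The comparison is weak, so that a
    matched pair is itself content. *)
Definition content M x y := exists2 z, M x z & rk x z <= rk x y.

Definition stable S M :=
  [/\ subrel M S, symmetric M, forall x y z, M x y -> M x z -> y = z
    & forall x y, S x y -> content M x y \/ content M y x].

Definition strict S :=
  forall x y z, S x y -> S x z -> rk x y = rk x z -> y = z.

Definition top S x y := S x y && [forall z, S x z ==> (rk x y <= rk x z)].

Lemma topP S x y :
  reflect (S x y /\ forall z, S x z -> rk x y <= rk x z) (top S x y).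
Proof.
apply: (iffP andP) => [[Sxy /forallP h]|[Sxy h]]; split=> //.
  by move=> z Sxz; apply: (implyP (h z)).
by apply/forallP=> z; apply/implyP=> /h.
Qed.

Lemma exists_top S x y : S x y -> exists z, top S x z.
Proof.
move=> Sxy; case: (arg_minnP (rk x) Sxy) => z Sxz zmin.
by exists z; apply/topP.
Qed.

Lemma strict_sub S S' : subrel S' S -> strict S -> strict S'.
Proof. by move=> sub h x y z /sub Sxy /sub; apply: h. Qed.

Definition arcs S := #|[set p : T * T | S p.1 p.2]|.

Lemma arcs_lt S S' x y :
  subrel S' S -> S x y -> ~~ S' x y -> arcs S' < arcs S.
Proof.
move=> sub Sxy nS'; apply/proper_card/properP; split.
  by apply/subsetP=> p; rewrite !inE; apply: sub.
by exists (x, y); rewrite inE.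
Qed.

(** Gale-Shapley by deletion. If two vertices on the side [s] have the same first choice, the edge
    from that vertex to the suitor it likes less can be removed. Once first choices are distinct,
    granting all of them is a stable matching. *)
Lemma stable_bipartite (s : T -> bool) S :
    symmetric S -> strict S -> (forall x y, S x y -> s x != s y) ->
  exists M, stable S M.
Proof.
have [n] := ubnP (arcs S); elim: n S => // n IHn S le_n symS strS bipS.
have [/existsP[d /existsP[d' /existsP[u H]]]|noc] :=
  boolP [exists d, exists d', exists u,
     [&& s d, s d', d != d', top S d u, top S d' u & rk u d <= rk u d']].
  case/and5P: H => sd sd' nd /topP[Sdu top_d] /andP[/topP[Sdu' top_d'] le_u].
  pose S' x y := S x y && ((x, y) \notin [:: (d', u); (u, d')]).
  have subS' : subrel S' S by move=> x y /andP[].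
  have symS' : symmetric S'.
    by move=> x y; rewrite /S' symS !inE !xpair_eqE orbC andbC
                           [(x == u) && _]andbC [(x == d') && _]andbC andbC.
  have nuc : u != d by apply: contraTneq (bipS _ _ Sdu) => ->; rewrite eqxx.
  have S'du : S' d u.
    by rewrite /S' Sdu !inE !xpair_eqE negb_or (negPf nd) (eq_sym d) (negPf nuc).
  have lt_S' : arcs S' < arcs S.
    by apply: (arcs_lt subS' Sdu'); rewrite /S' !inE eqxx andbF.
  have [|x y /subS'/bipS//|M [subM symM matM conM]] :=
      IHn S' (leq_trans lt_S' le_n) symS'.
    exact: strict_sub strS.
  exists M; split=> //; first by move=> x y /subM/subS'.
  (* The edge between [d] and [u] is still there. Either [d] is content, and then holds its first
     choice [u], or [u] holds a partner at least as good as [d]; both ways [u] does not regret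
     [d']. *)
  have con_u : content M u d'.
    have [[z Mdz le_z]|[z Muz le_z]] := conM _ _ S'du; last first.
      by exists z => //; apply: leq_trans le_u.
    have Sdz := subS' _ _ (subM _ _ Mdz).
    have zu : z = u by apply: (strS d) => //; apply/eqP; rewrite eqn_leq le_z top_d.
    rewrite zu symM in Mdz.
    by exists d.
  move=> x y Sxy; have [|] := boolP (S' x y); first exact: conM.
  by rewrite /S' Sxy !inE negbK => /orP[] /eqP[-> ->]; [right|left].
pose M x y := S x y && (if s x then top S x y else top S y x).
have symM : symmetric M.
  move=> x y; rewrite /M symS; case Syx: (S y x) => //=.
  by move: (bipS _ _ Syx); case: (s x); case: (s y).
exists M; split=> //.
- by move=> x y /andP[].
- move=> x y z /andP[Sxy +] /andP[Sxz]; have := bipS _ _ Sxy; have := bipS _ _ Sxz.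
  case sx: (s x) => sz sy.
    move=> /topP[_ hy] /topP[_ hz]; apply: (strS x) => //.
    by apply/eqP; rewrite eqn_leq hy ?hz.
  move=> ty tz; apply: contraNeq noc => nyz.
  have [sy' sz'] : s y /\ s z by case: (s y) (s z) sy sz => [] [].
  have [le|/ltnW le] := leqP (rk x y) (rk x z); apply/existsP.
    exists y; apply/existsP; exists z; apply/existsP; exists x.
    by apply/and5P; split=> //; apply/andP.
  exists z; apply/existsP; exists y; apply/existsP; exists x.
  by apply/and5P; split; rewrite 1?eq_sym //; apply/andP.
- have con x y : S x y -> s x -> content M x y.
    move=> Sxy sx; have [z tz] := exists_top Sxy; exists z.
      by rewrite /M sx tz; case/andP: tz => ->.
    by case/topP: tz => _; apply.
  move=> x y Sxy; have := bipS _ _ Sxy; case sx: (s x) => sy.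
    by left; apply: con.
  by right; apply: con; [rewrite symS | case: (s y) sy].
Qed.

(** Two vertices that rank each other first can be matched and removed, since every other edge at
    either of them is beaten there. The hypothesis speaks of all subgraphs so that it survives the
    removal. *)
Lemma stable_mutual_top (s : T -> bool) S :
    symmetric S -> strict S ->
    (forall S', symmetric S' -> subrel S' S ->
       (forall x y, S' x y -> s x != s y) \/
       exists x y, top S' x y /\ top S' y x) ->
  exists M, stable S M.
Proof.
have [n] := ubnP (arcs S); elim: n S => // n IHn S le_n symS strS hS.
have [|[x0 [y0 [/topP[Sxy tx] /topP[Syx ty]]]]] := hS S symS (fun _ _ => id).
  exact: stable_bipartite.
pose S' x y := [&& S x y, x \notin [:: x0; y0] & y \notin [:: x0; y0]].
have subS' : subrel S' S by move=> x y /andP[].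
have symS' : symmetric S' by move=> x y; rewrite /S' symS [X in _ && X]andbC.
have lt_S' : arcs S' < arcs S.
  by apply: (arcs_lt subS' Sxy); rewrite /S' !inE eqxx /= andbF.
have [||M [subM symM matM conM]] := IHn S' (leq_trans lt_S' le_n) symS'.
- exact: strict_sub strS.
- by move=> S'' sym'' sub''; apply: hS => // x y /sub''/subS'.
pose M' x y := M x y || ((x, y) \in [:: (x0, y0); (y0, x0)]).
have M'x : M' x0 y0 by rewrite /M' !inE eqxx orbT.
have M'y : M' y0 x0 by rewrite /M' !inE eqxx !orbT.
exists M'; split.
- by move=> x y /orP[/subM/subS'//|]; rewrite !inE => /orP[] /eqP[-> ->].
- by move=> x y; rewrite /M' symM !inE !xpair_eqE; do !case: eqP.
- have M0 x y : M x y -> x \notin [:: x0; y0] by move=> /subM/and3P[].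
  move=> x y z; rewrite /M' !inE !xpair_eqE.
  case/orP=> h1 /orP[] h2.
  + exact: matM h2.
  + by move: (M0 _ _ h1) h2; rewrite !inE; do 2!case: eqP.
  + by move: (M0 _ _ h2) h1; rewrite !inE; do 2!case: eqP.
  + by case/orP: h1 h2 => /andP[/eqP-> /eqP->] /orP[] /andP[/eqP h /eqP->].
- move=> x y Sxy'; have [|nS'] := boolP (S' x y).
    by move=> /conM[] [z Mz le]; [left|right]; exists z; rewrite // /M' Mz.
  have con a b : S a b -> a \in [:: x0; y0] -> content M' a b.
    by move=> Sab; rewrite !inE => /orP[] /eqP ea; rewrite ea in Sab *;
       [exists y0 | exists x0] => //; [apply: tx|apply: ty].
  move: nS'; rewrite /S' Sxy' /= negb_and !negbK => /orP[hx|hy].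
    by left; apply: con.
  by right; apply: con; rewrite 1?symS.
Qed.

Lemma eq_stable S S' M : S =2 S' -> stable S M -> stable S' M.
Proof.
move=> eqS [sub sym mat con]; split=> // x y; last by rewrite -eqS; apply: con.
by rewrite -eqS; apply: sub.
Qed.

Definition supported S (W : {set T}) := forall x y, S x y -> x \in W /\ y \in W.

(** The union is a matching because [M2] leaves the only common vertex [v] free; the edges dropped
    from [S2] are those that [M1] already takes care of. *)
Lemma stable_union v (W1 W2 : {set T}) S1 S2 S2' M1 M2 :
    (forall x, x \in W1 -> x \in W2 -> x = v) ->
    supported S1 W1 -> supported S2 W2 -> subrel S2' S2 ->
    stable S1 M1 -> stable S2' M2 -> (forall z, ~~ M2 v z) ->
    (forall x y, S2 x y -> ~~ S2' x y -> content M1 x y \/ content M1 y x) ->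
  stable (fun x y => S1 x y || S2 x y) (fun x y => M1 x y || M2 x y).
Proof.
move=> W12 S1W S2W subS [sub1 sym1 mat1 con1] [sub2 sym2 mat2 con2] M2v con12.
have con1U x y : content M1 x y -> content (fun x y => M1 x y || M2 x y) x y.
  by case=> z Mz le; exists z; rewrite ?Mz.
have con2U x y : content M2 x y -> content (fun x y => M1 x y || M2 x y) x y.
  by case=> z Mz le; exists z; rewrite ?Mz ?orbT.
split.
- by move=> x z /orP[/sub1->//|/sub2/subS->]; rewrite orbT.
- by move=> x z; rewrite sym1 sym2.
- have dis x z w : M1 x z -> M2 x w -> False.
    move=> /sub1/S1W[xW1 _] M2x; have [xW2 _] := S2W _ _ (subS _ _ (sub2 _ _ M2x)).
    by move: (M2v w); rewrite -(W12 x) ?M2x.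
  move=> x z w /orP[h1|h1] /orP[h2|h2]; first exact: mat1 h2.
  + by case: (dis _ _ _ h1 h2).
  + by case: (dis _ _ _ h2 h1).
  + exact: mat2 h2.
- move=> x z /orP[/con1[] /con1U|S2xz]; [by left|by right|].
  have [/con2[] /con2U|/(con12 _ _ S2xz)[] /con1U] := boolP (S2' x z);
    by [left | right].
Qed.

(** An induced subdigraph of the line graph comes from a subgraph of the graph, so this is
    kernel-perfectness in terms of matchings. *)
Definition solvable S :=
  forall S', symmetric S' -> subrel S' S -> exists M, stable S' M.

(* Among all stable matchings of the two sides, the one giving [v] its best
   partner extends to the other side after deletion of the edges at [v] that
   this partner beats: matching [v] there would give [v] a better partner. *)
Lemma stable_glue_match v n (W1 W2 : {set T}) S1 S2 y M1 :
    (forall x, x \in W1 -> x \in W2 -> x = v) ->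
    supported S1 W1 -> supported S2 W2 -> symmetric S1 -> symmetric S2 ->
    irreflexive S1 -> strict (fun x y => S1 x y || S2 x y) ->
    irreflexive S2 -> solvable S1 -> solvable S2 ->
    stable S1 M1 -> M1 v y -> rk v y < n ->
  exists M, stable (fun x y => S1 x y || S2 x y) M.
Proof.
elim: n W1 W2 S1 S2 y M1 => // n IHn W1 W2 S1 S2 y M1 W12 S1W S2W sym1 sym2.
move=> irr1 str irr2 sol1 sol2 st1 M1vy le_n.
pose S2' x z := [&& S2 x z, (x == v) ==> (rk v z <= rk v y)
                  & (z == v) ==> (rk v x <= rk v y)].
have subS : subrel S2' S2 by move=> x z /andP[].
have symS : symmetric S2' by move=> x z; rewrite /S2' sym2 [X in _ && X]andbC.
have nS2' x z : S2 x z -> ~~ S2' x z ->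
    x = v /\ rk v y <= rk v z \/ z = v /\ rk v y <= rk v x.
  move=> S2xz; rewrite /S2' S2xz /= negb_and !negb_imply -!ltnNge.
  by case/orP=> /andP[/eqP-> /ltnW]; [left|right].
have [M2 st2] := sol2 S2' symS subS.
have [/existsP[z M2vz]|nM2] := boolP [exists z, M2 v z]; last first.
  exists (fun x y => M1 x y || M2 x y).
  apply: (stable_union W12 S1W S2W subS) => //.
    by move=> z; apply: contraNN nM2 => M2z; apply/existsP; exists z.
  by move=> x z S2xz /(nS2' _ _ S2xz)[] [-> le]; [left|right]; exists y.
have [sub2 M2sym mat2 con2] := st2.
have S1vy : S1 v y by case: st1 => + _ _ _; apply.
have /and3P[S2vz + _] := sub2 _ _ M2vz; rewrite eqxx /= => le_z.
(* The two sides share only [v], so [z] differs from [y] and strictness of the ranks makes it a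
   strictly better partner of [v]. *)
have lt_z : rk v z < n.
  apply: leq_trans (_ : rk v y <= n) => //; rewrite ltn_neqAle le_z andbT.
  apply/eqP => /(str v z y); rewrite S2vz S1vy orbT => /(_ isT isT) zy.
  have yv : y = v by apply: W12; [case: (S1W _ _ S1vy)|rewrite -zy; case: (S2W _ _ S2vz)].
  by rewrite yv irr1 in S1vy.
(* The sides exchange roles. [M2] is stable for all of [S2]: an edge dropped at [v] is no better
   there than [y], hence no better than [z]. *)
have [|||M stM] := IHn W2 W1 S2 S1 z M2 _ S2W S1W sym2 sym1 irr2 _ irr1 sol2 sol1 _ M2vz lt_z.
- by move=> x xW2 xW1; apply: W12.
- by apply: strict_sub str => a b; rewrite orbC.
- split=> //; first by move=> a b /sub2/subS.
  move=> a b S2ab; have [/con2//|/(nS2' _ _ S2ab)] := boolP (S2' a b).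
  by case=> [] [-> le]; [left|right]; exists z => //; apply: leq_trans le.
- by exists M; apply: eq_stable stM => a b; rewrite orbC.
Qed.

Lemma solvable_glue v (W1 W2 : {set T}) S1 S2 :
    (forall x, x \in W1 -> x \in W2 -> x = v) ->
    supported S1 W1 -> supported S2 W2 -> symmetric S1 -> symmetric S2 ->
    irreflexive S1 -> irreflexive S2 -> strict (fun x y => S1 x y || S2 x y) ->
    solvable S1 -> solvable S2 ->
  solvable (fun x y => S1 x y || S2 x y).
Proof.
move=> W12 S1W S2W sym1 sym2 irr1 irr2 str sol1 sol2 S symS subS.
pose R1 x y := S x y && S1 x y; pose R2 x y := S x y && S2 x y.
have eqS : (fun x y => R1 x y || R2 x y) =2 S.
  by move=> x y; rewrite /R1 /R2 -andb_orr; apply: andb_idr => /subS.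
have symR1 : symmetric R1 by move=> x y; rewrite /R1 symS sym1.
have symR2 : symmetric R2 by move=> x y; rewrite /R2 symS sym2.
have solR1 : solvable R1 by move=> S' symS' sub; apply: sol1 => // x y /sub/andP[].
have solR2 : solvable R2 by move=> S' symS' sub; apply: sol2 => // x y /sub/andP[].
have strR : strict (fun x y => R1 x y || R2 x y).
  by apply: strict_sub str => x y; rewrite eqS; apply: subS.
have strR' : strict (fun x y => R2 x y || R1 x y).
  by apply: strict_sub strR => x y; rewrite orbC.
have R1W : supported R1 W1 by move=> x y /andP[_ /S1W].
have R2W : supported R2 W2 by move=> x y /andP[_ /S2W].
have irrR1 : irreflexive R1 by move=> x; rewrite /R1 irr1 andbF.
have irrR2 : irreflexive R2 by move=> x; rewrite /R2 irr2 andbF.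
have W21 x : x \in W2 -> x \in W1 -> x = v by move=> *; apply: W12.
suff [M stM] : exists M, stable (fun x y => R1 x y || R2 x y) M.
  by exists M; apply: eq_stable stM.
have [M1 st1] := solR1 R1 symR1 (fun _ _ => id).
have [M2 st2] := solR2 R2 symR2 (fun _ _ => id).
have [/existsP[y M1y]|_] := boolP [exists y, M1 v y].
  exact: (stable_glue_match W12 R1W R2W symR1 symR2 irrR1 strR irrR2 solR1 solR2 st1 M1y (ltnSn _)).
have [/existsP[y M2y]|nM2] := boolP [exists y, M2 v y].
  have [M stM] := stable_glue_match W21 R2W R1W symR2 symR1 irrR2 strR' irrR1
                    solR2 solR1 st2 M2y (ltnSn _).
  by exists M; apply: eq_stable stM => a b; rewrite orbC.
exists (fun x y => M1 x y || M2 x y).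
apply: (stable_union W12 R1W R2W _ st1 st2) => //; last by move=> x y ->.
by move=> z; apply: contraNN nM2 => M2z; apply/existsP; exists z.
Qed.

End StableMatching.

(** * Edge colourings of bipartite graphs *)

Section EdgeColouring.

Variable T : finType.
Implicit Types (g : rel T) (f : T -> T -> nat).

Definition proper_colouring k g f :=
  [/\ forall x y, g x y -> f x y = f y x, forall x y, g x y -> f x y < k
    & strict f g].

Lemma missing_colour k g f x :
  #|[set y | g x y]| < k -> exists2 c, c < k & forall y, g x y -> f x y != c.
Proof.
move=> deg; pose L := [seq f x y | y <- enum [set y | g x y]].
have [/allP sub|/allPn[c]] := boolP (all (mem L) (iota 0 k)).
  have := uniq_leq_size (iota_uniq 0 k) sub.
  by rewrite size_iota size_map -cardE leqNgt deg.
rewrite mem_iota add0n /= => ltc cL; exists c => // y gxy.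
apply: contraNneq cL => <-; apply: map_f.
by rewrite mem_enum inE.
Qed.

(* Kempe change: [R] is the component of [y0] in the subgraph of colours [a]
   and [b].  As [b] is missing at [y0] and sides alternate, [R] is reached by
   leaving the side of [y0] through [a] and the other side through [b]; hence a
   vertex of the other side where [a] is missing lies outside [R]. *)
Lemma kempe_change k g f (s : T -> bool) x0 y0 a b :
    symmetric g -> (forall x y, g x y -> s x != s y) -> proper_colouring k g f ->
    s x0 != s y0 -> a < k -> b < k ->
    (forall y, g x0 y -> f x0 y != a) -> (forall x, g y0 x -> f y0 x != b) ->
  exists f', [/\ proper_colouring k g f', forall y, g x0 y -> f' x0 y != a
              & forall x, g y0 x -> f' y0 x != a].
Proof.
move=> symg bip [symf ltf strf] sxy lta ltb missx missy.
pose col u := if s u == s y0 then a else b.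
pose r u w := g u w && (f u w == col u).
pose R := connect r y0.
have pred u : R u -> u != y0 -> exists2 u', R u' & r u' u.
  move=> /connectP[p + ->]; case/lastP: p => [|p w] /=; first by rewrite eqxx.
  rewrite last_rcons rcons_path => /andP[pp rw] _; exists (last y0 p) => //.
  by apply/connectP; exists p.
have closed u w : R u -> g u w -> (f u w == a) || (f u w == b) -> R w.
  move=> Ru guw fuw; have [fcol|fcol] := boolP (f u w == col u).
    by apply: connect_trans Ru (connect1 _); rewrite /r guw.
  have [uy|/(pred _ Ru)[u' Ru' /andP[gu' /eqP fu']]] := eqVneq u y0.
    have fb := missy w; rewrite -uy in fb.
    by move: fcol fuw (fb guw); rewrite /col uy eqxx; do 2!case: eqP.
  suff -> : w = u' by [].
  apply: (strf u) => //; first by rewrite symg.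
  rewrite -(symf _ _ gu') fu'; move: fcol fuw; rewrite /col.
  move: (bip _ _ gu'); case: (s u'); case: (s u); case: (s y0) => //= _;
    by do 2!case: eqP.
have nRx : ~~ R x0.
  apply/negP => Rx; have nxy : x0 != y0 by apply: contraNneq sxy => ->.
  have [u Ru /andP[gu /eqP]] := pred _ Rx nxy.
  rewrite (symf _ _ gu); have := missx u; rewrite symg gu /col => /(_ isT).
  by move: (bip _ _ gu) sxy; case: (s u); case: (s x0); case: (s y0) => //= _ _;
     case: eqP.
pose swap c := if c == a then b else if c == b then a else c.
have swap_inj : injective swap.
  by move=> c d; rewrite /swap; do !case: eqP; congruence.
exists (fun u w => if R u then swap (f u w) else f u w); split; first split.
- move=> x y gxy; rewrite -(symf _ _ gxy).
  have [fab|/norP[fa fb]] := boolP ((f x y == a) || (f x y == b)); last first.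
    by rewrite /swap (negPf fa) (negPf fb); do 2!case: ifP.
  suff -> : R x = R y by [].
  by apply/idP/idP => /closed; apply; rewrite // 1?symg // -symf.
- by move=> x y /ltf lt; rewrite /swap; do !case: ifP.
- move=> x y z gxy gxz; case: ifP => _; last exact: strf.
  by move/swap_inj; apply: strf.
- by move=> y gxy; rewrite (negPf nRx); apply: missx.
- move=> x gyx; have -> : R y0 by apply: connect0.
  by have := missy _ gyx; rewrite /swap; do !case: eqP; congruence.
Qed.

(** Delete an edge and colour the rest. Each of its ends misses some colour, and a Kempe change
    makes one colour missing at both, which the edge then receives. *)
Lemma koenig k g (s : T -> bool) :
    symmetric g -> (forall x y, g x y -> s x != s y) ->
    (forall x, #|[set y | g x y]| <= k) ->
  exists f, proper_colouring k g f.
Proof.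
have [n] := ubnP (arcs g); elim: n g => // n IHn g le_n symg bip deg.
have [/existsP[x0 /existsP[y0 gxy]]|nog] := boolP [exists x, exists y, g x y];
  last first.
  have nog' x y : ~~ g x y.
    by apply: contraNN nog => gxy; apply/existsP; exists x; apply/existsP; exists y.
  by exists (fun _ _ => 0); split=> x y; rewrite ?(negPf (nog' x y)).
pose g' x y := g x y && ((x, y) \notin [:: (x0, y0); (y0, x0)]).
have subg : subrel g' g by move=> x y /andP[].
have symg' : symmetric g'.
  move=> x y; rewrite /g' symg !inE !xpair_eqE orbC.
  by rewrite [(x == y0) && _]andbC [(x == x0) && _]andbC.
have bip' x y : g' x y -> s x != s y by move/subg/bip.
have lt_g : arcs g' < arcs g by apply: (arcs_lt subg gxy); rewrite /g' !inE eqxx andbF.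
have sub_deg x : [set y | g' x y] \subset [set y | g x y].
  by apply/subsetP => y; rewrite !inE; apply: subg.
have [|f propf] := IHn g' (leq_trans lt_g le_n) symg' bip'.
  by move=> x; apply: leq_trans (subset_leq_card _) (deg x).
have deg' x y : g x y -> ~~ g' x y -> #|[set z | g' x z]| < k.
  move=> gxy' ng'; apply: leq_trans (proper_card _) (deg x).
  by apply/properP; split=> //; exists y; rewrite inE.
have gyx : g y0 x0 by rewrite symg.
have ng' : ~~ g' x0 y0 by rewrite /g' !inE eqxx andbF.
have ng'' : ~~ g' y0 x0 by rewrite symg'.
have [a lta missx] := missing_colour f (deg' _ _ gxy ng').
have [b ltb missy] := missing_colour f (deg' _ _ gyx ng'').
have [f' [[symf ltf strf] missx' missy']] :=
  kempe_change symg' bip' propf (bip _ _ gxy) lta ltb missx missy.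
pose new x y := (x, y) \in [:: (x0, y0); (y0, x0)].
have newC x y : new x y = new y x.
  by rewrite /new !inE !xpair_eqE orbC [(x == y0) && _]andbC [(x == x0) && _]andbC.
have old x y : g x y -> ~~ new x y -> g' x y by rewrite /g' => -> ->.
have missn x y z : new x y -> g x z -> ~~ new x z -> f' x z != a.
  by rewrite {1}/new !inE => /orP[] /eqP[-> _] gz nz; [apply: missx'|apply: missy'];
    apply: old.
have nxy : x0 != y0 by apply: contraTneq (bip _ _ gxy) => ->; rewrite eqxx.
exists (fun x y => if new x y then a else f' x y); split.
- by move=> x y gxy'; rewrite newC; case: ifPn => // nn; apply/symf/old; rewrite // newC.
- by move=> x y gxy'; case: ifPn => // nn; apply: ltf; apply: old.
- move=> x y z gy gz; case: ifPn => ny; case: ifPn => nz.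
  + move: ny nz; rewrite /new !inE !xpair_eqE.
    case/orP=> /andP[/eqP-> /eqP->]; rewrite eqxx ?(negPf nxy) 1?eq_sym ?(negPf nxy);
      by rewrite /= ?orbF => /eqP.
  + by move=> fz; have := missn x y z ny gz nz; rewrite -fz eqxx.
  + by move=> fy; have := missn x z y nz gy ny; rewrite fy eqxx.
  + by apply: strf; apply: old.
Qed.

(** Permuting the colours keeps a colouring proper, so the colours seen at [v] can be moved into
    [A]. *)
Lemma koenig_at k g (s : T -> bool) v (A : seq nat) :
    symmetric g -> (forall x y, g x y -> s x != s y) ->
    (forall x, #|[set y | g x y]| <= k) ->
    uniq A -> {subset A <= gtn k} -> #|[set y | g v y]| <= size A ->
  exists2 f, proper_colouring k g f & forall y, g v y -> f v y \in A.
Proof.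
move=> symg bip deg uniqA ltA degv; have [f [symf ltf strf]] := koenig symg bip deg.
pose u := [seq f v y | y <- enum [set y | g v y]].
have ltu : {subset u <= gtn k}.
  by move=> c /mapP[y]; rewrite mem_enum inE => gvy ->; apply: ltf.
have uniqu : uniq u.
  rewrite map_inj_in_uniq ?enum_uniq // => y z; rewrite !mem_enum !inE.
  exact: strf.
(* [L B] lists all [k] colours with [B] in front, and [pi] below sends each entry of [L u] to the
   entry of [L A] in the same place. As [u] is no longer than [A], it lands inside [A]. *)
pose L (B : seq nat) := B ++ [seq c <- iota 0 k | c \notin B].
have permL B : uniq B -> {subset B <= gtn k} -> perm_eq (L B) (iota 0 k).
  move=> uniqB ltB; apply: uniq_perm; rewrite ?iota_uniq //.
    rewrite cat_uniq uniqB filter_uniq ?iota_uniq // andbT /=.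
    by apply/hasPn => c; rewrite mem_filter => /andP[].
  move=> c; rewrite mem_cat mem_filter mem_iota add0n /=.
  by case: (boolP (c \in B)) => //= /ltB.
have pu := permL u uniqu ltu; have pA := permL A uniqA ltA.
have sz : size (L A) = size (L u) by rewrite (perm_size pA) (perm_size pu).
pose pi c := nth 0 (L A) (index c (L u)).
have idx c : c < k -> index c (L u) < size (L A).
  by move=> ltc; rewrite sz index_mem (perm_mem pu) mem_iota add0n.
have pi_lt c : c < k -> pi c < k.
  move=> /idx /(mem_nth 0); rewrite (perm_mem pA) mem_iota add0n; exact.
have pi_inj c d : c < k -> d < k -> pi c = pi d -> c = d.
  move=> ltc ltd /eqP; rewrite nth_uniq ?idx // => [/eqP e|]; last first.
    by rewrite (perm_uniq pA) iota_uniq.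
  have mem x : x < k -> x \in L u by move=> h; rewrite (perm_mem pu) mem_iota add0n.
  by rewrite -(nth_index 0 (mem c ltc)) e nth_index ?mem.
exists (fun x y => pi (f x y)); first split.
- by move=> x y gxy; rewrite symf.
- by move=> x y gxy; apply/pi_lt/ltf.
- move=> x y z gy gz /pi_inj e; apply: (strf x) => //; apply: e; exact: ltf.
move=> y gvy; have fu : f v y \in u by apply: map_f; rewrite mem_enum inE.
have lt : index (f v y) (L u) < size A.
  rewrite index_cat fu; apply: leq_trans degv.
  by rewrite cardE -(size_map (f v)) index_mem.
by rewrite /pi nth_cat lt mem_nth.
Qed.

End EdgeColouring.

(** * Graphs without odd cycles are bipartite *)

Section Bipartite.

Variables (T : finType) (g : rel T).
Hypothesis symg : symmetric g.

(** A repeated vertex splits a closed walk into two shorter ones whose lengths add up to the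
    original length, so one of them is odd. *)
Lemma odd_cycle_ucycle c :
  cycle g c -> odd (size c) -> exists2 c', ucycle g c' & odd (size c').
Proof.
have [n] := ubnP (size c); elim: n c => // n IHn c le_n cyc odd_c.
have [uc|nu] := boolP (uniq c); first by exists c; rewrite // /ucycle cyc.
have [p1 [x [p2 [defc xp]]]] : exists p1 x p2, c = p1 ++ x :: p2 /\ x \in p2.
  elim: {cyc odd_c le_n} c nu => //= x c IHc; rewrite negb_and negbK.
  have [xc _|_ /IHc[p1 [y [p2 [-> yp]]]]] := boolP (x \in c).
    by exists [::], x, c.
  by exists (x :: p1), y, p2.
have : x \in p2 ++ p1 by rewrite mem_cat xp.
have: cycle g (x :: p2 ++ p1).
  by rewrite -cat_cons -rot_size_cat rot_cycle -defc.
have : size c = (size (p2 ++ p1)).+1 by rewrite defc !size_cat addnC.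
move: (p2 ++ p1) => p szc cyc' /splitPr def_p; case: def_p szc cyc' => q1 q2.
rewrite size_cat /= => szc; rewrite rcons_cat cat_path /= => /and3P[cyc1 g1 cyc2].
have cycq1 : cycle g (x :: q1) by rewrite /= rcons_path cyc1.
have cycq2 : cycle g (x :: q2) by [].
have [o1|e1] := boolP (odd (size (x :: q1))).
  apply: (IHn (x :: q1)) => //; apply: leq_trans (le_n : size c <= n).
  by rewrite szc /= ltnS addnS ltnS leq_addr.
apply: (IHn (x :: q2)) => //.
  by apply: leq_trans (le_n : size c <= n); rewrite szc /= ltnS addnS ltnS leq_addl.
by move: odd_c e1; rewrite szc /= oddD /= !negbK; case: odd; case: odd.
Qed.

Lemma no_odd_cycle_bipartite :
    (forall c, ucycle g c -> ~~ odd (size c)) ->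
  exists s : T -> bool, forall x y, g x y -> s x != s y.
Proof.
move=> noodd.
have closed r p : path g r p -> last r p = r -> ~~ odd (size p).
  case: p => // a p; move=> pp lp; apply/negP => odd_p.
  have cyc : cycle g (a :: p) by move: pp lp => /= /andP[ga pp] lp; rewrite rcons_path pp lp.
  by have [c uc] := odd_cycle_ucycle cyc odd_p; rewrite (negPf (noodd _ uc)).
(* [e2] is the bipartite double cover, so [s x] says that some walk of odd length leads to [x] from
   the root of its component. *)
pose e2 : rel (T * bool) := fun p q => g p.1 q.1 && (p.2 != q.2).
pose r := root g; pose s x := connect e2 (r x, false) (x, true).
have sP x y b : reflect (exists2 p, path g x p & last x p = y /\ odd (size p) = b)
                        (connect e2 (x, false) (y, b)).
  suff lift q c d : path e2 (q, c) d ->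
      path g q (map fst d) /\ (last (q, c) d) = (last q (map fst d), c (+) odd (size d)).
    apply: (iffP connectP) => [[d pd ed]|[p pp [lp szp]]].
      have [pg] := lift _ _ _ pd; rewrite -ed => -[-> eb].
      by exists (map fst d); rewrite // size_map.
    suff [d pd ed] : exists2 d, path e2 (x, false) d & last (x, false) d = (last x p, false (+) odd (size p)).
      by exists d; rewrite // ed lp szp.
    elim: p (x) false {lp szp} pp => [|z p IHp] w c /=.
      by exists [::]; rewrite //= addbF.
    case/andP=> gwz /(IHp _ (~~ c))[d pd ed]; exists ((z, ~~ c) :: d) => /=.
      by rewrite /e2 /= gwz pd; case: c {pd ed}.
    by rewrite ed; case: c {pd ed}; case: odd.
  elim: d q c => [|[z b'] d IHd] q c /=; first by rewrite addbF.
  by case/andP=> /andP[/= -> nc] /IHd[-> ->]; move: nc; case: c; case: b'; case: odd.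
exists s => x y gxy.
have eqr : r y = r x.
  by apply/esym/(rootP (sym_connect_sym symg)); apply: connect1.
rewrite /s eqr; apply/eqP => es.
(* Odd walks to both ends would close up through the edge into an odd closed walk. If [x] has no odd
   walk, it has an even one, and the edge extends it to an odd walk to [y]. *)
have [sx|nsx] := boolP (connect e2 (r x, false) (x, true)).
  have /sP[p pp [lp op]] := sx; move: es; rewrite sx => /esym/sP[q pq [lq oq]].
  have := closed (r x) (rcons p y ++ rev (belast (r x) q)).
  rewrite cat_path rcons_path pp lp gxy last_rcons -{1}lq rev_path /=.
  rewrite (@eq_path _ _ g) ?pq; last by move=> a b /=; rewrite symg.
  move=> /(_ isT); rewrite size_cat size_rcons size_rev size_belast.
  rewrite oddD /= op oq; case: (q) lq oq => // a q' _ _ /=.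
  by rewrite rev_cons last_cat last_rcons => /(_ erefl).
have : connect g (r x) x by rewrite (sym_connect_sym symg) connect_root.
case/connectP=> p pp lp; case op: (odd (size p)).
  by case/negP: nsx; apply/sP; exists p.
move: es; rewrite (negPf nsx) => /esym/negP[]; apply/sP; exists (rcons p y).
  by rewrite rcons_path pp -lp.
by rewrite last_rcons size_rcons /= op.
Qed.

End Bipartite.

(** * Blocks that contain a triangle *)

Section Structure.

Variables (T : finType) (e : rel T).
Hypotheses (e_sym : symmetric e) (e_irr : irreflexive e).
Hypothesis no_long_odd_cycle : forall c, ucycle e c -> odd (size c) -> size c < 5.

Definition restrict (W : {set T}) : rel T := fun x y => [&& e x y, x \in W & y \in W].

Lemma restrict_sym W : symmetric (restrict W).
Proof. by move=> x y; rewrite /restrict e_sym [X in _ && X]andbC. Qed.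

(** No edge between [C] and [z] is required, so a disconnected [W] on at least three vertices is
    separated as well. *)
Definition separation (W C : {set T}) z :=
  [/\ C \subset W, z \in W :\: C, C != set0, z |: C != W
    & forall x y, x \in C -> y \in W -> e x y -> y \in C \/ y = z].

(** This is K_{1,1,n} with spine [a b]; an edge (n = 0) and a triangle (n = 1) are included. *)
Definition book (W : {set T}) a b :=
  [/\ a \in W, b \in W, e a b,
      forall x, x \in W -> x != a -> x != b -> e x a && e x b
    & forall x y, x \in W :\: [set a; b] -> y \in W :\: [set a; b] -> ~~ e x y].

Definition complete4 (W : {set T}) :=
  #|W| = 4 /\ forall x y, x \in W -> y \in W -> x != y -> e x y.

(** A component outside the triangle sees at least two of its vertices, or it could be separated,
    and long odd cycles appear unless all these contacts start at one vertex; that vertex is then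
    the whole component. Two outer vertices that see different pairs of the triangle give a 5-cycle.
    Hence either some outer vertex sees the whole triangle and is the only one, or all see the same
    pair, which is the spine, and the third vertex of the triangle is one more page. *)
Lemma nonseparable_triangle (W : {set T}) a b c :
    a \in W -> b \in W -> c \in W -> e a b -> e b c -> e a c ->
    (forall C z, ~ separation W C z) ->
  (exists a' b', book W a' b') \/ complete4 W.
Proof.
move=> aW bW cW eab ebc eac nosep.
pose tri := [:: a; b; c]; pose O := W :\: [set x in tri].
have neq x y : e x y -> x != y by apply: contraTneq => ->; rewrite e_irr.
have eT t t' : t \in tri -> t' \in tri -> t != t' -> e t t'.
  by rewrite !inE => /or3P[] /eqP-> /or3P[] /eqP->; rewrite ?eqxx // e_sym.
have third t t' : t \in tri -> t' \in tri -> t != t' ->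
    exists t'', [/\ t'' \in tri, t'' != t, t'' != t' & {subset tri <= [:: t; t'; t'']}].
  have [ab bc ac] := And3 (neq _ _ eab) (neq _ _ ebc) (neq _ _ eac).
  rewrite !inE => /or3P[] /eqP-> /or3P[] /eqP->; rewrite ?eqxx // => _;
    [exists c|exists b|exists c|exists a|exists b|exists a];
    (split; [by rewrite !inE eqxx ?orbT | by rewrite // eq_sym | by rewrite // eq_sym |]);
    by move=> x; rewrite !inE; do !case: eqP.
have triW t : t \in tri -> t \in W by rewrite !inE => /or3P[] /eqP->.
have triO t : t \in tri -> t \notin O by move=> tt; rewrite !inE in tt *; rewrite tt.
have WO x : x \in W -> x \notin tri -> x \in O by move=> xW nt; rewrite !inE in nt *; rewrite nt xW.
have OW x : x \in O -> x \in W by case/setDP.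
pose h := restrict O.
have symh : connect_sym h by apply/sym_connect_sym/restrict_sym.
have conO x y : x \in O -> connect h x y -> y \in O.
  move=> xO /connectP[p + ->]; elim: p x xO => //= z p IHp x _ /andP[/and3P[_ _ zO]].
  exact: IHp.
have pathO r x : path h x r -> all (mem O) r.
  by elim: r x => //= z r IHr x /andP[/and3P[_ _ ->] /IHr].
(* A path from [p] to [q] outside the triangle closes up through one or through
   two edges of the triangle; one of these cycles is odd, and long if [p != q]. *)
have ear p q t t' : p \in O -> connect h p q -> t \in tri -> t' \in tri -> t != t' ->
    e p t -> e q t' -> p = q.
  move=> pO /connectP[s0 ps0 lq] tt tt' ntt ept eqt.
  have [t3 [tt3 nt3 nt3' _]] := third _ _ tt tt' ntt.
  case/shortenP: ps0 lq => s ps us _ lq; case: s ps us lq => // y s ps us lq.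
  have sO : {subset p :: y :: s <= O}.
    move: (y :: s) ps {us lq} => r pr x; rewrite inE => /predU1P[-> //|xr].
    by move: (allP (pathO _ _ pr)) => /(_ x xr).
  have us' t0 : t0 \in tri -> t0 \notin p :: y :: s.
    by move=> /triO; apply: contra => /sO.
  have es : path e p (y :: s) by apply: sub_path ps => ? ? /and3P[].
  move: (y :: s) es us us' lq (isT : 0 < size (y :: s)) {ps sO} => r er ur ur' lq szr.
  have base l : path e t' (rcons l t) -> uniq (t :: t' :: l) -> {subset l <= tri} ->
      ~~ odd (size r + size l) -> False.
    move=> pl ul subl odd_l.
    have sz : size (t :: p :: r ++ t' :: l) = (size r + size l).+3.
      by rewrite /= size_cat /= addnS.
    suff : size (t :: p :: r ++ t' :: l) < 5.
      by rewrite sz; move: szr odd_l; clear; case: (size r) (size l) => [|[|m]] [|l'].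
    apply: no_long_odd_cycle; last by rewrite sz /= negbK odd_l.
    apply/andP; split.
      rewrite /= rcons_cat cat_path er e_sym ept /= -lq eqt /=; exact: pl.
    rewrite -(cat_cons p) cons_uniq mem_cat negb_or cat_uniq ur.
    move: ul; rewrite cons_uniq => /andP[-> ->]; rewrite !andbT (ur' _ tt) /=.
    apply/norP; split; first exact: ur'.
    by apply/hasPn => x /subl /ur'.
  case odd_r: (odd (size r)).
    case: (base [:: t3]) => /=.
    - by rewrite !eT // eq_sym.
    - by rewrite !inE negb_or ntt eq_sym nt3 eq_sym nt3'.
    - by move=> x; rewrite inE => /eqP->.
    - by rewrite addn1 /= odd_r.
  case: (base [::]) => //=; first by rewrite eT // eq_sym.
    by rewrite inE ntt.
  by rewrite addn0 odd_r.
have attach x : x \in O ->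
    (exists t t', [/\ t \in tri, t' \in tri, t != t' & e x t && e x t'])
    /\ forall y, y \in O -> ~~ e x y.
  move=> xO; pose C := [set y | connect h x y].
  have CO y : y \in C -> y \in O by rewrite inE; apply: conO.
  have CW : C \subset W by apply/subsetP => y /CO/OW.
  have xC : x \in C by rewrite inE connect0.
  have triC t : t \in tri -> t \notin C by move/triO; apply: contra => /CO.
  have neqW (C' : {set T}) : C' \subset C -> C' != W.
    move=> sub; apply: contraNneq (triC a _) => [eqC|]; last by rewrite !inE eqxx.
    by apply: (subsetP sub); rewrite eqC.
  have Cnb u y : u \in C -> y \in W -> e u y -> y \in C \/ y \in tri.
    move=> uC yW euy; have [|yt] := boolP (y \in tri); [by right|left].
    move: (uC); rewrite !inE => cxu; apply: connect_trans cxu (connect1 _).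
    by rewrite /h /restrict euy (CO _ uC) WO.
  (* Otherwise [t] would separate [C] from the other two vertices of the triangle. *)
  have other t : t \in tri -> exists u t', [/\ u \in C, t' \in tri, t' != t & e u t'].
    move=> tt.
    have [/existsP[u /existsP[t' /and4P[]]]|no] :=
        boolP [exists u, exists t', [&& u \in C, t' \in tri, t' != t & e u t']].
      by exists u, t'.
    case: (nosep C t); split=> //.
    - by apply/setDP; split; [apply: triW | apply: triC].
    - by apply/set0Pn; exists x.
    - have [t2 tt2 nt2] : exists2 t2, t2 \in tri & t2 != t.
        move: tt (neq _ _ eab); rewrite inE => /predU1P[->|_ _]; last first.
          have [->|] := eqVneq t b; first by exists a; rewrite ?inE ?eqxx //; apply: neq.
          by exists b; rewrite ?inE ?eqxx ?orbT // eq_sym.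
        by exists b; rewrite ?inE ?eqxx ?orbT // eq_sym.
      apply: contraNneq (triC _ tt2) => eqW.
      by have := triW _ tt2; rewrite -eqW !inE (negPf nt2).
    - move=> u y uC yW euy; have [|yt] := Cnb _ _ uC yW euy; [by left|right].
      apply: contraNeq no => ny.
      by apply/existsP; exists u; apply/existsP; exists y; rewrite uC yt ny.
  have [|u1 [t1 [uC1 tt1 _ eu1]]] := other a; first by rewrite inE eqxx.
  have [u2 [t2 [uC2 tt2 nt21 eu2]]] := other _ tt1.
  have conC u u' : u \in C -> u' \in C -> connect h u u'.
    by rewrite !inE symh => cu cu'; apply: connect_trans cu cu'.
  have u12 : u1 = u2.
    by apply: (ear u1 u2 t1 t2) => //; [apply: CO | apply: conC | rewrite eq_sym].
  move: eu2; rewrite -u12 => {uC2 u12} eu2.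
  (* [u1] sees both [t1] and [t2], and at least one of them differs from [t], so [ear] applies. *)
  have uniq_att r t : r \in C -> t \in tri -> e r t -> r = u1.
    move=> rC tt ert; have [tt1'|nt] := eqVneq t t1; last first.
      by apply: (ear r u1 t t1) => //; [apply: CO | apply: conC].
    by apply: (ear r u1 t t2) => //; [apply: CO | apply: conC | rewrite tt1' eq_sym].
  (* All contacts with the triangle pass through [u1], which would separate the rest of [C]. *)
  have eqC : C = [set u1].
    apply/eqP; case: eqP => // /eqP nC; case: (nosep (C :\ u1) u1); split.
    - by apply: subset_trans CW; apply: subD1set.
    - by rewrite !inE eqxx /= OW // CO.
    - apply: contraNneq nC => C0; rewrite eqEsubset sub1set uC1 andbT.
      apply/subsetP => y yC; apply: contraTT isT => ny.
      by have := in_set0 y; rewrite -C0 !inE in ny *; rewrite inE in yC; rewrite ny yC.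
    - by rewrite setD1K // neqW.
    - move=> u y; rewrite in_setD1 => /andP[nu uC] yW euy.
      have [->|ny] := eqVneq y u1; [by right|left]; rewrite in_setD1 ny.
      have [//|/(uniq_att _ _ uC) yt] := Cnb _ _ uC yW euy.
      by rewrite yt ?eqxx in nu.
  have xu : x = u1 by move: xC; rewrite eqC inE => /eqP.
  split; first by exists t1, t2; rewrite xu eu1 eu2 eq_sym.
  move=> y yO; apply/negP => exy.
  have [|] := Cnb x y xC (OW _ yO) exy; last by move/triO; rewrite yO.
  by rewrite eqC inE -xu => /eqP yx; rewrite yx e_irr in exy.
have five x y t1 t2 t3 : x \in O -> y \in O -> x != y ->
    t1 \in tri -> t2 \in tri -> t3 \in tri -> uniq [:: t1; t2; t3] ->
    e x t1 -> e x t2 -> e y t2 -> e y t3 -> False.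
  move=> xO yO nxy tt1 tt2 tt3 u3 ex1 ex2 ey2 ey3.
  have not_tri z t : z \in O -> t \in tri -> (z == t) = false.
    by move=> zO tt; apply: contraTF zO => /eqP->; apply: triO.
  suff : size [:: t1; x; t2; y; t3] < 5 by [].
  apply: no_long_odd_cycle => //; apply/andP; split => /=.
    rewrite (e_sym t1) ex1 ex2 (e_sym t2) ey2 ey3 /= andbT.
    apply: eT; rewrite // eq_sym.
    by move: u3; rewrite /= !inE negb_or => /andP[/andP[]].
  move: u3; rewrite /= !inE !negb_or (negPf nxy) !(eq_sym _ x) !(eq_sym _ y).
  by rewrite !(not_tri x _ xO) // !(not_tri y _ yO) //= => /andP[/andP[-> ->] /andP[-> _]].
have tri3 : uniq tri by rewrite /= !inE negb_or !neq.
have [/existsP[x /and4P[xO exa exb exc]]|nofull] :=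
    boolP [exists x, [&& x \in O, e x a, e x b & e x c]].
  right; have eqW : W = x |: [set y in tri].
    apply/setP => y; rewrite in_setU1 inE; apply/idP/idP; last first.
      by case/orP=> [/eqP->|/triW//]; apply: OW.
    move=> yW; apply/orP; have [|/(WO _ yW) yO] := boolP (y \in tri); [by right|left].
    apply: contraT => nyx; have [[t [t' [tt tt' ntt /andP[eyt eyt']]]] _] := attach y yO.
    have ext t0 : t0 \in tri -> e x t0 by rewrite !inE => /or3P[] /eqP->.
    have [t3 [tt3 nt3 nt3' _]] := third _ _ tt tt' ntt.
    case: (five y x t t' t3) => //; rewrite ?ext //= !inE negb_or ntt.
    by rewrite eq_sym nt3 eq_sym nt3'.
  have ext t0 : t0 \in tri -> e x t0 by rewrite !inE => /or3P[] /eqP->.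
  split.
    rewrite eqW cardsU1 inE; have -> : x \notin tri by apply: contraL xO; apply: triO.
    by rewrite cardsE (card_uniqP tri3).
  move=> y z; rewrite eqW !in_setU1 ![_ \in [set _ in _]]inE.
  case/predU1P=> [->|yt] /predU1P[->|zt]; rewrite ?eqxx // => nyz.
  + exact: ext.
  + by rewrite e_sym ext.
  + exact: eT.
left; have [/eqP O0|/set0Pn[x xO]] := boolP (O == set0).
  exists a, b; split=> // [x xW nxa nxb|x y].
    have : x \in tri by apply: contraT => /(WO _ xW); rewrite O0 inE.
    by rewrite !inE (negPf nxa) (negPf nxb) => /eqP->; rewrite !(e_sym c) eac ebc.
  have Wc z : z \in W :\: [set a; b] -> z = c.
    rewrite !inE negb_or => /andP[/andP[nza nzb] zW].
    have : z \in tri by apply: contraT => /(WO _ zW); rewrite O0 inE.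
    by rewrite !inE (negPf nza) (negPf nzb) => /eqP.
  by move=> /Wc-> /Wc->; rewrite e_irr.
have [[t [t' [tt tt' ntt /andP[ext ext']]]] _] := attach x xO.
have [t3 [tt3 nt3 nt3' sub3]] := third _ _ tt tt' ntt.
have u3 : uniq [:: t; t'; t3] by rewrite /= !inE negb_or ntt eq_sym nt3 eq_sym nt3'.
have u3' : uniq [:: t'; t; t3].
  by rewrite /= !inE negb_or eq_sym ntt eq_sym nt3' eq_sym nt3.
have pages y : y \in O -> [/\ e y t, e y t' & ~~ e y t3].
  move=> yO; have nyt3 : ~~ e y t3.
    have [->|nyx] := eqVneq y x.
      apply: contraNN nofull => ext3; apply/existsP; exists x; rewrite xO.
      have all3 t0 : t0 \in tri -> e x t0.
        by move=> /sub3; rewrite !inE => /or3P[] /eqP->.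
      by rewrite !all3 // !inE eqxx ?orbT.
    apply/negP => eyt3.
    have [[s [s' [ts ts' ns /andP[eys eys']]]] _] := attach y yO.
    have [s0 ts0 [ns0 eys0]] : exists2 s0, s0 \in tri & s0 != t3 /\ e y s0.
      have [es|] := eqVneq s t3; last by exists s.
      by exists s' => //; split=> //; rewrite -es eq_sym.
    move: (sub3 _ ts0); rewrite !inE (negPf ns0) orbF => /orP[] /eqP es0;
      rewrite es0 in eys0.
      by apply: (five x y t' t t3); rewrite // eq_sym.
    by apply: (five x y t t' t3); rewrite // eq_sym.
  split=> //; have [[s [s' [ts ts' ns /andP[eys eys']]]] _] := attach y yO;
  have ns3 : s != t3 by [apply: contraNneq nyt3 => <-];
  have ns3' : s' != t3 by [apply: contraNneq nyt3 => <-];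
  move: (sub3 _ ts) (sub3 _ ts'); rewrite !inE (negPf ns3) (negPf ns3') !orbF;
  by case/orP=> /eqP es /orP[] /eqP es'; rewrite es es' ?eqxx in ns eys eys' *.
exists t, t'; split; [exact: triW|exact: triW|exact: eT| |].
  move=> y yW nyt nyt'; have [yt|/(WO _ yW)/pages[-> ->]//] := boolP (y \in tri).
  have := sub3 _ yt; rewrite !inE (negPf nyt) (negPf nyt') => /eqP->.
  by rewrite !eT.
have out y : y \in W :\: [set t; t'] -> y = t3 \/ y \in O.
  case/setDP=> yW; rewrite in_set2 negb_or => /andP[nyt nyt'].
  have [yt|/(WO _ yW)] := boolP (y \in tri); last by move=> yO; right.
  by left; have := sub3 _ yt; rewrite !inE (negPf nyt) (negPf nyt') => /eqP.
move=> y z /out[->|yO] /out[->|zO]; first by rewrite e_irr.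
+ by rewrite e_sym; case: (pages _ zO).
+ by case: (pages _ yO).
+ by have [_] := attach y yO; apply.
Qed.

End Structure.

(** * Colourings that induce proper Galvin orientations: symmetry and gluing *)

Section GoodColouring.

Variables (T : finType) (k : nat).
Implicit Types (g : rel T) (s : T -> bool) (f : T -> T -> nat).

(* [s x] means [x \in D], where small colours are preferred; colours shift so
   that a smaller rank is always better. *)
Definition rank s f x y := if s x then f x y else k - f x y.

(* The condition on monochromatic edges keeps outdegrees below [k]: a [D]-[D]
   edge of colour [j] has at most [j] smaller colours at each end. *)
Definition good g s f :=
  [/\ proper_colouring k g f,
      forall x y, g x y -> s x = s y ->
        if s x then (f x y).*2 <= k.-1 else k.-1 <= (f x y).*2
    & solvable (rank s f) g].

Lemma strict_rank g s f : proper_colouring k g f -> strict (rank s f) g.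
Proof.
move=> [_ ltf strf] x y z gy gz; have := ltf _ _ gy; have := ltf _ _ gz.
by rewrite /rank; case: (s x) => lz ly e; apply: (strf x) => //; lia.
Qed.

Lemma solvable_mono g (rk rk' : T -> T -> nat) :
    (forall x y z, g x y -> g x z -> rk x y <= rk x z -> rk' x y <= rk' x z) ->
  solvable rk g -> solvable rk' g.
Proof.
move=> mono sol S symS sub; have [M [subM symM matM con]] := sol S symS sub.
exists M; split=> // x y Sxy; have Syx : S y x by rewrite symS.
by case: (con _ _ Sxy) => [] [z Mz le]; [left|right]; exists z => //;
   apply: mono le; apply: sub => //; apply: subM.
Qed.

Lemma good_ext g g' s s' f f' :
    symmetric g -> g =2 g' -> (forall x y, g x y -> s x = s' x) ->
    (forall x y, g x y -> f x y = f' x y) -> good g s f -> good g' s' f'.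
Proof.
move=> symg eqg eqs eqf [[symf ltf strf] mono sol].
have eqg' x y : g' x y -> g x y by rewrite eqg.
split; first split.
- move=> x y /eqg' gxy; have gyx : g y x by rewrite symg.
  by rewrite -(eqf _ _ gxy) -(eqf _ _ gyx) symf.
- by move=> x y /eqg' gxy; rewrite -(eqf _ _ gxy) ltf.
- by move=> x y z /eqg' gy /eqg' gz; rewrite -(eqf _ _ gy) -(eqf _ _ gz); apply: strf.
- move=> x y /eqg' gxy; have gyx : g y x by rewrite symg.
  by rewrite -(eqf _ _ gxy) -(eqs _ _ gxy) -(eqs _ _ gyx); apply: mono.
- move=> S symS sub; have := sol S symS (fun x y h => eqg' _ _ (sub x y h)).
  have subS : subrel S g by move=> x y /sub/eqg'.
  move=> [M [subM symM matM con]]; exists M; split=> // x y Sxy.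
  have eqr a b : S a b -> rank s f a b = rank s' f' a b.
    by move/subS=> gab; rewrite /rank -(eqs _ _ gab) -(eqf _ _ gab).
  have Syx : S y x by rewrite symS.
  by case: (con _ _ Sxy) => [] [z Mz le]; [left|right]; exists z => //;
     rewrite -(eqr _ _ (subM _ _ Mz)) -eqr.
Qed.

Lemma good_flip g s f :
  good g s f -> good g (fun x => ~~ s x) (fun x y => k.-1 - f x y).
Proof.
move=> [[symf ltf strf] mono sol]; split; first split.
- by move=> x y gxy; rewrite symf.
- by move=> x y /ltf; lia.
- move=> x y z gy gz e; apply: (strf x) => //.
  by have := ltf _ _ gy; have := ltf _ _ gz; lia.
- move=> x y gxy /negb_inj /(mono _ _ gxy); have := ltf _ _ gxy.
  by case: (s x) => /=; lia.
(* At each vertex the new ranks are the old ones shifted by one, up or down, so all comparisons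
   persist. *)
- apply: solvable_mono sol => x y z /ltf ly /ltf lz; rewrite /rank.
  by case: (s x) => /=; lia.
Qed.

Lemma good_glue v (W1 W2 : {set T}) g1 g2 s1 s2 f1 f2 :
    (forall x, x \in W1 -> x \in W2 -> x = v) ->
    supported g1 W1 -> supported g2 W2 -> symmetric g1 -> symmetric g2 ->
    irreflexive g1 -> irreflexive g2 -> s1 v = s2 v ->
    (forall y z, g1 v y -> g2 v z -> f1 v y != f2 v z) ->
    good g1 s1 f1 -> good g2 s2 f2 ->
  good (fun x y => g1 x y || g2 x y) (fun x => if x \in W1 then s1 x else s2 x)
       (fun x y => if g1 x y then f1 x y else f2 x y).
Proof.
move=> W12 g1W g2W sym1 sym2 irr1 irr2 sv fv good1 good2.
pose s x := if x \in W1 then s1 x else s2 x.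
pose f x y := if g1 x y then f1 x y else f2 x y.
suff: good (fun x y => g1 x y || g2 x y) s f by [].
have g12 x y : g2 x y -> g1 x y = false.
  move=> h2; apply: contraTF (h2) => h1.
  have [[x1 y1] [x2 y2]] := (g1W _ _ h1, g2W _ _ h2).
  by rewrite (W12 x) // (W12 y) // irr2.
have {}good1 : good g1 s f.
  apply: good_ext good1 => // x y gxy; last by rewrite /f gxy.
  by rewrite /s; case: (g1W _ _ gxy) => ->.
have {}good2 : good g2 s f.
  apply: good_ext good2 => // x y gxy; last by rewrite /f g12.
  rewrite /s; case: (g2W _ _ gxy) => x2 _; case: ifP => // x1.
  by rewrite (W12 x).
have [[sym_f1 lt1 str1] mono1 sol1] := good1.
have [[sym_f2 lt2 str2] mono2 sol2] := good2.
have fv' x y z : g1 x y -> g2 x z -> f x y != f x z.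
  move=> h1 h2; have xv : x = v.
    by apply: W12; [case: (g1W _ _ h1)|case: (g2W _ _ h2)].
  by rewrite {2}/f g12 // /f h1; rewrite xv in h1 h2 *; apply: fv.
have prop : proper_colouring k (fun x y => g1 x y || g2 x y) f.
  split.
  - by move=> x y /orP[/sym_f1|/sym_f2].
  - by move=> x y /orP[/lt1|/lt2].
  - move=> x y z /orP[hy|hy] /orP[hz|hz] fe.
    + exact: (str1 x).
    + by have := fv' _ _ _ hy hz; rewrite fe eqxx.
    + by have := fv' _ _ _ hz hy; rewrite fe eqxx.
    + exact: (str2 x).
split=> //.
  by move=> x y /orP[/mono1|/mono2].
exact: (solvable_glue W12 g1W g2W) (strict_rank prop) _ _.
Qed.

End GoodColouring.

(** * Colourings with a prescribed root: gluing and bipartite blocks *)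

Section Rooted.

Variables (T : finType) (e : rel T) (k : nat).
Hypotheses (e_sym : symmetric e) (e_irr : irreflexive e).
Hypothesis deg_e : forall x, #|[set y | e x y]| < k.

Local Notation restrict := (restrict e).

Definition nbrs W x := [set y | restrict W x y].

(* Prescribing the class of a root and more colours than its degree is what
   makes the statement pass through cut vertices. *)
Definition rooted W v b := forall A : seq nat,
  sorted ltn A -> {subset A <= gtn k} -> #|nbrs W v| < size A ->
  exists s f, [/\ good k (restrict W) s f, s v = b
                & forall y, restrict W v y -> f v y \in A].

Lemma restrict_irr W : irreflexive (restrict W).
Proof. by move=> x; rewrite /restrict e_irr. Qed.

Lemma restrict_supported W : supported (restrict W) W.
Proof. by move=> x y /and3P[]. Qed.

Lemma nbrs_lt W x : #|nbrs W x| < k.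
Proof.
apply: leq_ltn_trans (deg_e x); apply: subset_leq_card.
by apply/subsetP => y; rewrite !inE => /and3P[].
Qed.

Lemma rooted_flip W v : rooted W v true -> rooted W v false.
Proof.
move=> rt A sA ltA degA; pose B := rev [seq k.-1 - c | c <- A].
have [|||s [f [gd sv fv]]] := rt B.
- rewrite /B rev_sorted sorted_map.
  apply: sub_in_sorted sA => // c d cA dA /= lt.
  by have := ltA _ cA; have := ltA _ dA; rewrite !inE /=; lia.
- by move=> c; rewrite mem_rev => /mapP[d /ltA + ->]; rewrite !inE /=; lia.
- by rewrite size_rev size_map.
exists (fun x => ~~ s x), (fun x y => k.-1 - f x y); split.
- exact: good_flip.
- by rewrite sv.
- move=> y /fv; rewrite mem_rev => /mapP[c cA ->].
  by have := ltA _ cA; rewrite !inE /= => lt; have -> : k.-1 - (k.-1 - c) = c by lia.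
Qed.

Lemma size_unused (A B : seq nat) :
  uniq A -> size A - size B <= size [seq c <- A | c \notin B].
Proof.
move=> uA; rewrite leq_subLR size_filter -(count_predC (mem B)) leq_add2r.
rewrite -size_filter; apply: uniq_leq_size; first exact: filter_uniq.
by move=> c; rewrite mem_filter => /andP[].
Qed.

Lemma rooted_glue (X Y : {set T}) z v b :
    (forall x, x \in X -> x \in Y -> x = z) -> z \in X -> z \in Y ->
    (forall x y, restrict (X :|: Y) x y = restrict X x y || restrict Y x y) ->
    v \in X -> rooted X v b -> (forall b', rooted Y z b') ->
  rooted (X :|: Y) v b.
Proof.
move=> XY zX zY eqr vX rX rY A sA ltA degA.
have nbU x : nbrs (X :|: Y) x = nbrs X x :|: nbrs Y x.
  by apply/setP=> y; rewrite !inE eqr.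
have [|s1 [f1 [good1 s1v f1v]]] := rX A sA ltA.
  by apply: leq_ltn_trans degA; rewrite nbU; apply/subset_leq_card/subsetUl.
(* When the root is the cut vertex itself, the edges of [Y] at it must also take their colours from
   [A]; otherwise all [k] colours are allowed at [z]. *)
pose A0 := if v == z then A else iota 0 k.
have sA0 : sorted ltn A0 by rewrite /A0; case: ifP => // _; apply: iota_ltn_sorted.
have ltA0 : {subset A0 <= gtn k}.
  by rewrite /A0; case: ifP => // _ c; rewrite mem_iota.
have degA0 : #|nbrs (X :|: Y) z| < size A0.
  by rewrite /A0; case: eqP => [<-//|_]; rewrite size_iota nbrs_lt.
pose used := [seq f1 z y | y <- enum (nbrs X z)].
pose A' := [seq c <- A0 | c \notin used].
have nb_dis : #|nbrs (X :|: Y) z| = #|nbrs X z| + #|nbrs Y z|.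
  rewrite nbU cardsU; suff -> : nbrs X z :&: nbrs Y z = set0 by rewrite cards0 subn0.
  apply/setP=> y; rewrite !inE; apply/negP=> /andP[/and3P[ezy _ yX] /and3P[_ _ yY]].
  by rewrite (XY y) ?e_irr in ezy.
have [|||s2 [f2 [good2 s2z f2z]]] := rY (s1 z) A'.
- by apply: sorted_filter => //; apply: ltn_trans.
- by move=> c; rewrite mem_filter => /andP[_ /ltA0].
- have uA0 : uniq A0 by apply: sorted_uniq sA0; [apply: ltn_trans|apply: ltnn].
  apply: leq_trans (size_unused used uA0).
  by rewrite size_map -cardE; move: degA0; rewrite nb_dis; lia.
exists (fun x => if x \in X then s1 x else s2 x).
exists (fun x y => if restrict X x y then f1 x y else f2 x y); split.
- have symr W := restrict_sym e_sym W.
  have fz y w : restrict X z y -> restrict Y z w -> f1 z y != f2 z w.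
    move=> hy /f2z; rewrite mem_filter => /andP[+ _]; apply: contraNneq => <-.
    by apply: map_f; rewrite mem_enum inE.
  have := good_glue XY (@restrict_supported X) (@restrict_supported Y) (symr X)
    (symr Y) (@restrict_irr X) (@restrict_irr Y) (esym s2z) fz good1 good2.
  apply: good_ext => // x y.
  by rewrite !(symr _ x).
- by rewrite vX.
- move=> y; rewrite eqr; case: ifP => [h _|_ /=]; first exact: f1v.
  move=> h; have vz : v = z by apply: XY => //; case/and3P: h.
  by rewrite vz in h *; have := f2z _ h; rewrite mem_filter /A0 vz eqxx => /andP[].
Qed.

(** Every edge joins D to U, so the condition on monochromatic edges is void and any proper
    colouring with the right colours at [v] will do. *)
Lemma rooted_bipartite W v b (s0 : T -> bool) :
  (forall x y, restrict W x y -> s0 x != s0 y) -> rooted W v b.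
Proof.
move=> bip A sA ltA degA.
pose s x := (s0 x == s0 v) == b.
have bips x y : restrict W x y -> s x != s y.
  by move/bip; rewrite /s; case: (s0 x); case: (s0 y); case: (s0 v); case: (b).
have uA : uniq A by apply: sorted_uniq sA; [apply: ltn_trans|apply: ltnn].
have [f prop fv] := koenig_at (restrict_sym e_sym W) bips
  (fun x => ltnW (nbrs_lt W x)) uA ltA (ltnW degA).
exists s, f; split=> //; last by rewrite /s eqxx.
split=> //; first by move=> x y /bips /eqP.
move=> S symS sub; apply: (stable_bipartite (s := s)) => //.
  exact: strict_sub (strict_rank prop).
by move=> x y /sub/bips.
Qed.

(** * Books *)

Lemma book_swap W a b : book e W a b -> book e W b a.
Proof.
case=> aW bW eab pg ind; split=> //; first by rewrite e_sym.
  by move=> x xW nb na; rewrite andbC pg.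
by rewrite setUC.
Qed.

Section BookColouring.

Variables (W : {set T}) (a b : T) (P : seq T) (c0 : nat) (l : seq nat).
Hypotheses (bk : book e W a b) (defP : P =i W :\: [set a; b]).
Hypotheses (ul : uniq (c0 :: l)) (ltl : {subset c0 :: l <= gtn k}).
Hypothesis szl : size P < size l.

(* The [i]-th page gets the [i]-th colour of [l] towards [a] and the next one
   towards [b]. *)
Definition book_colour x y :=
  if x == a then (if y == b then c0 else nth 0 l (index y P))
  else if x == b then (if y == a then c0 else nth 0 l (index y P).+1)
  else if y == a then nth 0 l (index x P) else nth 0 l (index x P).+1.

Lemma book_neq : a != b.
Proof. by case: bk => _ _ + _ _; apply: contraTneq => ->; rewrite e_irr. Qed.

Lemma page_neq x : x \in P -> (x == a = false) * (x == b = false).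
Proof.
by rewrite defP !inE negb_or => /andP[/andP[/negPf-> /negPf->]].
Qed.

Lemma page_edge x : x \in P -> e x a && e x b.
Proof.
case: bk => _ _ _ + _ xP; have [nxa nxb] := page_neq xP; apply; rewrite ?nxa ?nxb //.
by move: xP; rewrite defP => /setDP[].
Qed.

Lemma book_edge x y : restrict W x y ->
  [\/ x = a /\ (y = b \/ y \in P), x = b /\ (y = a \/ y \in P)
    | x \in P /\ (y = a \/ y = b)].
Proof.
case: bk => aW bW eab pg ind /and3P[exy xW yW].
have cases z : z \in W -> [\/ z = a, z = b | z \in P].
  move=> zW; have [->|nza] := eqVneq z a; first by constructor 1.
  have [->|nzb] := eqVneq z b; first by constructor 2.
  by constructor 3; rewrite defP !inE negb_or nza nzb.
have [xa|xb|xP] := cases _ xW; have [ya|yb|yP] := cases _ yW.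
- by rewrite xa ya e_irr in exy.
- by constructor 1; split=> //; left.
- by constructor 1; split=> //; right.
- by constructor 2; split=> //; left.
- by rewrite xb yb e_irr in exy.
- by constructor 2; split=> //; right.
- by constructor 3; split=> //; left.
- by constructor 3; split=> //; right.
- by move: xP yP; rewrite !defP => xP /(ind _ _ xP); rewrite exy.
Qed.

Lemma book_colourE :
  [/\ book_colour a b = c0, book_colour b a = c0,
      forall x, x \in P -> book_colour a x = nth 0 l (index x P) /\
                           book_colour x a = nth 0 l (index x P)
    & forall x, x \in P -> book_colour b x = nth 0 l (index x P).+1 /\
                           book_colour x b = nth 0 l (index x P).+1].
Proof.
have nab := book_neq; have nba : b == a = false by rewrite eq_sym (negPf nab).
split; rewrite /book_colour ?eqxx ?nba //.
  by move=> x xP; rewrite !page_neq // eqxx.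
by move=> x xP; rewrite !page_neq // eqxx nba.
Qed.

Lemma nth_l_lt i : i < size l -> nth 0 l i < k.
Proof. by move=> lt; apply: ltl; rewrite inE mem_nth ?orbT. Qed.

Lemma book_index x : x \in P -> index x P < size l /\ (index x P).+1 < size l.
Proof.
by rewrite -index_mem => lt; have := leq_ltn_trans lt szl; split; first exact: ltnW.
Qed.

Lemma book_proper : proper_colouring k (restrict W) book_colour.
Proof.
have [fab fba fa fb] := book_colourE.
have ltc : c0 < k by apply: ltl; rewrite inE eqxx.
have nc i : i < size l -> c0 = nth 0 l i -> False.
  by move: ul => /= /andP[nl _] lt e0; rewrite e0 mem_nth in nl.
have ninj i j : i < size l -> j < size l -> nth 0 l i = nth 0 l j -> i = j.
  by move=> li lj /eqP; rewrite nth_uniq // => [/eqP //|]; case/andP: ul.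
have idx_inj x y : x \in P -> y \in P -> index x P = index y P -> x = y.
  by move=> xP yP e0; rewrite -(nth_index a xP) e0 nth_index.
split.
- move=> x y /book_edge[] [hx [hy|hy]].
  + by rewrite hx hy fab fba.
  + by rewrite hx; case: (fa _ hy) => -> ->.
  + by rewrite hx hy fab fba.
  + by rewrite hx; case: (fb _ hy) => -> ->.
  + by rewrite hy; case: (fa _ hx) => -> ->.
  + by rewrite hy; case: (fb _ hx) => -> ->.
- move=> x y /book_edge[] [hx [hy|hy]].
  + by rewrite hx hy fab.
  + by rewrite hx; case: (fa _ hy) => -> _; apply: nth_l_lt; case: (book_index hy).
  + by rewrite hx hy fba.
  + by rewrite hx; case: (fb _ hy) => -> _; apply: nth_l_lt; case: (book_index hy).
  + by rewrite hy; case: (fa _ hx) => _ ->; apply: nth_l_lt; case: (book_index hx).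
  + by rewrite hy; case: (fb _ hx) => _ ->; apply: nth_l_lt; case: (book_index hx).
- have nab := book_neq.
  have aP : a \in P = false by apply/negP => /page_neq[]; rewrite eqxx.
  have bP : b \in P = false by apply/negP => /page_neq[_]; rewrite eqxx.
  move=> x y z /book_edge h1 /book_edge h2; case: h1 => -[hx hy]; case: h2 => -[hx' hz].
  + rewrite hx; case: hy => hy; case: hz => hz; rewrite ?hy ?hz //.
    * by rewrite fab; case: (fa _ hz) => -> _ /nc[]; case: (book_index hz).
    * by rewrite fab; case: (fa _ hy) => -> _ /esym/nc[]; case: (book_index hy).
    * case: (fa _ hy) (fa _ hz) => -> _ [-> _] /ninj e0; apply: idx_inj => //.
      by apply: e0; [case: (book_index hy)|case: (book_index hz)].
  + by rewrite -hx -hx' eqxx in nab.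
  + by rewrite hx aP in hx'.
  + by rewrite -hx -hx' eqxx in nab.
  + rewrite hx; case: hy => hy; case: hz => hz; rewrite ?hy ?hz //.
    * by rewrite fba; case: (fb _ hz) => -> _ /nc[]; case: (book_index hz).
    * by rewrite fba; case: (fb _ hy) => -> _ /esym/nc[]; case: (book_index hy).
    * case: (fb _ hy) (fb _ hz) => -> _ [-> _] /ninj e0; apply: idx_inj => //.
      by apply/succn_inj/e0; [case: (book_index hy)|case: (book_index hz)].
  + by rewrite hx bP in hx'.
  + by rewrite hx' aP in hx.
  + by rewrite hx' bP in hx.
  + have [i1 i2] := book_index hx; case: (fa _ hx) (fb _ hx) => _ fxa [_ fxb].
    case: hy => hy; case: hz => hz; rewrite hy hz ?fxa ?fxb //.
      by move/(ninj _ _ i1 i2)/n_Sn.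
    by move/(ninj _ _ i2 i1)/esym/n_Sn.
Qed.

End BookColouring.

Lemma card_nbrs_spine W a b (P : seq T) :
  book e W a b -> uniq P -> P =i W :\: [set a; b] -> #|nbrs W a| = (size P).+1.
Proof.
move=> bk uP defP; have [aW bW eab pg _] := bk.
have -> : nbrs W a = b |: [set x in P].
  apply/setP=> y; rewrite in_setU1 !inE; apply/idP/idP.
    case/(book_edge bk defP) => [] [ha [hy|hy]].
    - by rewrite hy eqxx.
    - by rewrite hy orbT.
    - by rewrite ha e_irr in eab.
    - by rewrite ha e_irr in eab.
    - by have := page_neq defP ha; rewrite eqxx => -[].
    - by have := page_neq defP ha; rewrite eqxx => -[].
  case/predU1P=> [->|yP]; first by rewrite /restrict eab aW bW.
  have /andP[eya _] := page_edge bk defP yP.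
  by move: yP; rewrite defP => /setDP[yW _]; rewrite /restrict e_sym eya aW yW.
rewrite cardsU1 inE; have -> : b \notin P.
  by apply/negP => /(page_neq defP)[_]; rewrite eqxx.
by rewrite cardsE (card_uniqP uP).
Qed.

(** The list is used in increasing order. So the spine edge has the least colour of all, and every
    page has a larger colour towards [b] than towards [a]; each of the two cases for the class of
    [b] rests on one of these facts. *)
Lemma rooted_spine W a b : book e W a b -> rooted W a true.
Proof.
move=> bk A sA ltA degA; pose P := enum (W :\: [set a; b]).
have uP : uniq P by apply: enum_uniq.
have defP : P =i W :\: [set a; b] by move=> x; rewrite mem_enum.
rewrite (card_nbrs_spine bk uP defP) in degA.
have uA : uniq A by apply: sorted_uniq sA; [apply: ltn_trans|apply: ltnn].
case: A sA uA ltA degA => // c0 l sA uA ltA; move=> szl.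
(* With n pages [A] has more than n+1 colours, so beside [c0] there remain at least the n+1 that the
   shifted pattern needs. *)
have {}szl : size P < size l by [].
have prop := book_proper bk defP uA ltA szl.
have [fab fba fa fb] := book_colourE c0 l bk defP.
have lt_l i j : i < j -> j < size l -> nth 0 l i < nth 0 l j.
  move=> ij jl; have := @sorted_ltn_nth _ ltn ltn_trans 0 (c0 :: l) sA i.+1 j.+1.
  by rewrite !inE /= !ltnS; apply=> //; apply: ltn_trans jl.
have lt_c i : i < size l -> c0 < nth 0 l i.
  move=> il; have := @sorted_ltn_nth _ ltn ltn_trans 0 (c0 :: l) sA 0 i.+1.
  by rewrite !inE /= !ltnS; apply.
set f := book_colour _ _ _ _ _ in prop fab fba fa fb.
(* If the edge [a b] has too large a colour for [b] to join [a] in [D], then so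
   have all edges at [b], which joins the pages in [U]. *)
pose low := c0.*2 <= k.-1.
pose s x := (x == a) || (x == b) && low.
have sa : s a by rewrite /s eqxx.
have nab := book_neq bk.
have sb : s b = low by rewrite /s eq_sym (negPf nab) eqxx.
have sP x : x \in P -> s x = false.
  by move=> xP; rewrite /s !(page_neq defP).
have idx x : x \in P -> index x P < size l /\ (index x P).+1 < size l.
  exact: book_index.
have aW x : x \in P -> c0 < f a x /\ f a x < f b x.
  move=> xP; have [i1 i2] := idx _ xP.
  case: (fa _ xP) (fb _ xP) => -> _ [-> _]; split; [exact: lt_c|exact: lt_l].
exists s, f; split=> //; last first.
  move=> y /(book_edge bk defP)[] [ha [hy|hy]].
  - by rewrite hy fab inE eqxx.
  - by case: (fa _ hy) => -> _; rewrite inE mem_nth ?orbT //; case: (idx _ hy).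
  - by rewrite ha eqxx in nab.
  - by rewrite ha eqxx in nab.
  - by have := page_neq defP ha; rewrite eqxx => -[].
  - by have := page_neq defP ha; rewrite eqxx => -[].
have symr x y : restrict W x y -> f x y = f y x by case: prop => + _ _; apply.
split=> //.
  have mono x y : restrict W x y -> x = b -> s x = s y ->
      if s x then (f x y).*2 <= k.-1 else k.-1 <= (f x y).*2.
    move=> h xb; rewrite xb in h *; rewrite sb.
    case/(book_edge bk defP): h => [] [hb [hy|hy]].
    - by rewrite hb eqxx in nab.
    - by rewrite hb eqxx in nab.
    - by rewrite hy sa fba => lowT; rewrite lowT.
    - rewrite (sP _ hy) => nlow; rewrite nlow; move/negbT: nlow; rewrite /low -ltnNge.
      have [lta ltb] := aW _ hy => /ltnW le; apply: leq_trans le _.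
      by rewrite leq_double; apply/ltnW/(ltn_trans lta).
    - by have := page_neq defP hb; rewrite eqxx => -[].
    - by have := page_neq defP hb; rewrite eqxx => -[].
  move=> x y h exy; have hyx : restrict W y x by rewrite restrict_sym.
  case/(book_edge bk defP): (h) => [] [hx [hy|hy]]; try exact: mono.
  - by rewrite exy (symr _ _ h); apply: mono.
  - by rewrite hx sa (sP _ hy) in exy.
  - by rewrite hy sa (sP _ hx) in exy.
  - by rewrite exy (symr _ _ h); apply: mono.
move=> S symS sub; apply: (stable_mutual_top (s := s)) => //.
  exact: strict_sub (strict_rank prop).
move=> S' symS' subS.
have subS' x y : S' x y -> restrict W x y by move=> /subS/sub.
(* If [a] and [b] are both in D, the spine edge is the only monochromatic one and has the least
   colour at both ends. *)
have [lowT|lowF] := boolP low.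
  have [Sab|nSab] := boolP (S' a b).
    have Sba : S' b a by rewrite symS'.
    right; exists a, b; split; apply/topP; split=> // z Sz;
      rewrite /rank ?sa ?sb ?lowT ?fab ?fba;
      case/subS'/(book_edge bk defP): Sz => [] [hx [hz|hz]]; rewrite ?hz ?fab ?fba //;
      by [rewrite hx eqxx in nab | case: (aW _ hz) => lta ltb; rewrite ltnW // (ltn_trans lta)
         | have := page_neq defP hx; rewrite eqxx => -[]].
  left=> x y Sxy; case/subS'/(book_edge bk defP): (Sxy) => [] [hx [hy|hy]].
  - by rewrite hx hy (negPf nSab) in Sxy.
  - by rewrite hx sa (sP _ hy).
  - by rewrite hx hy symS' (negPf nSab) in Sxy.
  - by rewrite hx sb lowT (sP _ hy).
  - by rewrite hy sa (sP _ hx).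
  - by rewrite hy sb lowT (sP _ hx).
(* Now [b] and the pages prefer large colours. Among the pages still joined to [b], the last one has
   the largest colour at [b], and its edge to [a] has a smaller colour, so it and [b] rank each
   other first. *)
have [/existsP[p0 h0]|nobP] := boolP [exists p, (p \in P) && S' b p].
  right; case: (@arg_maxnP _ p0 (fun p => (p \in P) && S' b p) (fun p => index p P) h0).
  move=> p /andP[pP Sbp] pmax; exists b, p.
  have sbF : s b = false by rewrite sb (negPf lowF).
  have [ip1 ip2] := idx _ pP.
  have Spb : S' p b by rewrite symS'.
  split; apply/topP; split=> // z Sz; rewrite /rank ?sbF ?(sP _ pP).
    apply: leq_sub2l; case/subS'/(book_edge bk defP): (Sz) => [] [hx [hz|hz]].
    - by rewrite hx eqxx in nab.
    - by rewrite hx eqxx in nab.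
    - by rewrite hz fba; have [lta ltb] := aW _ pP; apply/ltnW/(ltn_trans lta).
    - have : index z P <= index p P by apply: pmax; rewrite hz Sz.
      case: (fb _ hz) (fb _ pP) => -> _ [-> _].
      by rewrite leq_eqVlt => /orP[/eqP->//|lt]; apply/ltnW/lt_l.
    - by have := page_neq defP hx; rewrite eqxx => -[].
    - by have := page_neq defP hx; rewrite eqxx => -[].
  apply: leq_sub2l; case: (aW _ pP) (fb _ pP) => _ lt [fbp ->]; rewrite fbp in lt.
  case/subS'/(book_edge bk defP): (Sz) => [] [hx [hz|hz]].
  - by have := page_neq defP pP; rewrite hx eqxx => -[].
  - by have := page_neq defP pP; rewrite hx eqxx => -[].
  - by have := page_neq defP pP; rewrite hx eqxx => -[].
  - by have := page_neq defP pP; rewrite hx eqxx => -[].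
  - by rewrite hz; case: (fa _ pP) lt => -> ->; apply: ltnW.
  - by rewrite hz; case: (fb _ pP) => _ ->.
have noS p : p \in P -> S' b p = false.
  by move=> pP; apply/negP => Sbp; case/existsP: nobP; exists p; rewrite pP.
left=> x y Sxy; case/subS'/(book_edge bk defP): (Sxy) => [] [hx [hy|hy]].
- by rewrite hx hy sa sb (negPf lowF).
- by rewrite hx sa (sP _ hy).
- by rewrite hx hy sa sb (negPf lowF).
- by rewrite hx noS in Sxy.
- by rewrite hy sa (sP _ hx).
- by rewrite hy symS' noS in Sxy.
Qed.

(** All pages go to D and the spine to U. The spine edge gets the largest colour k-1, allowed inside
    U and a first choice of both its ends; without it the graph is bipartite. Listing [v] as the
    first page gives its two edges the colours [c1] and [c2]. *)
Lemma rooted_page W a b v :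
  book e W a b -> v \in W -> v != a -> v != b -> rooted W v true.
Proof.
move=> bk vW nva nvb A sA ltA degA; have [aW bW eab pg _] := bk.
have /andP[eva evb] := pg _ vW nva nvb.
pose P := v :: enum (W :\: [set a; b] :\ v).
have uP : uniq P by rewrite /= enum_uniq mem_enum !inE eqxx.
have defP : P =i W :\: [set a; b].
  move=> x; rewrite inE mem_enum in_setD1; have [->|//] := eqVneq x v.
  by rewrite !inE negb_or nva nvb.
have nab := book_neq bk.
have : 2 < size A.
  apply: leq_ltn_trans degA; have -> : 2 = #|[set a; b]| by rewrite cards2 nab.
  (* The third colour obtained here forces [c1] and [c2] below k-1, the colour of the spine edge. *)
  apply/subset_leq_card/subsetP => x.
  by rewrite !inE => /orP[] /eqP->; rewrite /restrict ?eva ?evb vW ?aW ?bW.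
case: A sA ltA {degA} => // c1 [|c2 [|c3 A]] // sA ltA _.
have [lt12 lt23] : c1 < c2 /\ c2 < c3 by case/and3P: sA.
have lt3 : c3 < k by apply: ltA; rewrite !inE eqxx !orbT.
have k_gt0 : 0 < k by apply: leq_ltn_trans lt3.
have lt2 : c2 < k.-1 by rewrite -ltnS prednK //; apply: leq_ltn_trans lt23 lt3.
have lt1 : c1 < k.-1 by apply: ltn_trans lt2.
have kpred : k.-1 < k by rewrite prednK.
pose l := c1 :: c2 :: [seq c <- iota 0 k.-1 | c \notin [:: c1; c2]].
have ltl : {subset l <= gtn k.-1}.
  move=> c; rewrite !inE => /or3P[/eqP->|/eqP->|] //.
  by rewrite mem_filter mem_iota => /andP[_].
have ul : uniq (k.-1 :: l).
  rewrite cons_uniq; apply/andP; split; first by apply/negP => /ltl; rewrite inE ltnn.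
  by rewrite /= !inE negb_or !mem_filter !inE !eqxx ?orbT /= neq_ltn lt12
             filter_uniq ?iota_uniq.
have ltl' : {subset k.-1 :: l <= gtn k}.
  by move=> c; rewrite inE => /predU1P[->//|/ltl lt]; apply: ltn_trans kpred.
have szl : size P < size l.
  have ltP : size P < k.-1.
    have := nbrs_lt W a; rewrite (card_nbrs_spine bk uP defP) => lt.
    by rewrite -ltnS prednK.
  apply: leq_trans ltP _; have := size_unused [:: c1; c2] (iota_uniq 0 k.-1).
  by rewrite size_iota leq_subLR.
have prop := book_proper bk defP ul ltl' szl.
have [fab fba fa fb] := book_colourE k.-1 l bk defP.
set f := book_colour _ _ _ _ _ in prop fab fba fa fb.
have bounds x y : restrict W x y -> f x y < k by case: prop => _ + _; apply.
pose s x := (x != a) && (x != b).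
have sa : s a = false by rewrite /s eqxx.
have sb : s b = false by rewrite /s eqxx andbF.
have sP x : x \in P -> s x by move=> xP; rewrite /s !(page_neq defP).
have bip x y : restrict W x y -> [|| s x != s y, (x, y) == (a, b) | (x, y) == (b, a)].
  case/(book_edge bk defP) => [] [hx [hy|hy]]; rewrite ?hx ?hy ?eqxx ?orbT //;
  by rewrite ?sa ?sb ?sP.
have vP : v \in P by rewrite inE eqxx.
exists s, f; split=> //; last 2 first.
- exact: sP.
- move=> y /(book_edge bk defP)[] [hv [hy|hy]].
  + by rewrite hv eqxx in nva.
  + by rewrite hv eqxx in nva.
  + by rewrite hv eqxx in nvb.
  + by rewrite hv eqxx in nvb.
  + by case: (fa _ vP) => _; rewrite hy => ->; rewrite /= eqxx !inE eqxx.
  + by case: (fb _ vP) => _; rewrite hy => ->; rewrite /= eqxx !inE eqxx orbT.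
split=> //.
  move=> x y /bip /or3P[/eqP//|/eqP[-> ->]|/eqP[-> ->]] _;
  by rewrite ?sa ?sb ?fab ?fba -addnn leq_addr.
move=> S symS sub; apply: (stable_mutual_top (s := s)) => //.
  exact: strict_sub (strict_rank prop).
move=> S' symS' subS.
have subS' x y : S' x y -> restrict W x y by move=> /subS/sub.
have [Sab|nSab] := boolP (S' a b).
  have Sba : S' b a by rewrite symS'.
  right; exists a, b; split; apply/topP; split=> // z Sz;
  by rewrite /rank ?sa ?sb ?fab ?fba; apply: leq_sub2l;
     rewrite -ltnS prednK // bounds // subS'.
left=> x y Sxy; case/or3P: (bip _ _ (subS' _ _ Sxy)) => // /eqP[hx hy].
  by rewrite hx hy (negPf nSab) in Sxy.
by rewrite hx hy symS' (negPf nSab) in Sxy.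
Qed.

(** * The complete graph on four vertices *)

Lemma rooted_complete4 W v : complete4 e W -> v \in W -> rooted W v true.
Proof.
move=> [cardW eW] vW A sA ltA degA.
have eqnb : nbrs W v = W :\ v.
  apply/setP=> y; rewrite !inE /restrict vW; apply/idP/idP.
    by case/and3P=> evy _ ->; rewrite andbT; apply: contraTneq evy => ->; rewrite e_irr.
  by case/andP=> nyv yW; rewrite eW // eq_sym.
have cardv : #|W :\ v| = 3 by have := cardsD1 v W; rewrite vW cardW => -[].
rewrite eqnb cardv in degA.
case defE: (enum (W :\ v)) (cardE (W :\ v)) => [|a [|b [|c []]]] //; rewrite ?cardv // => _.
pose P := [:: v; a; b; c].
have uW : uniq P by rewrite /P -defE cons_uniq enum_uniq mem_enum !inE eqxx.
have memW x : x \in W -> [\/ x = v, x = a, x = b | x = c].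
  move=> xW; have [->|nxv] := eqVneq x v; first by constructor 1.
  have : x \in enum (W :\ v) by rewrite mem_enum !inE nxv xW.
  by rewrite defE !inE => /or3P[] /eqP->;
     [constructor 2|constructor 3|constructor 4].
case: A sA ltA degA => [|c0 [|c1 [|c2 [|c3 A]]]] // sA ltA _.
have [lt01 lt12 lt23] : [/\ c0 < c1, c1 < c2 & c2 < c3] by case/and4P: sA.
have lt3 : c3 < k by apply: ltA; rewrite !inE eqxx !orbT.
have [iv ia ib ic] : [/\ index v P = 0, index a P = 1, index b P = 2 & index c P = 3].
  move: uW; rewrite /= !inE !negb_or => /and4P[/and3P[va vb vc] /andP[ab ac] bc _].
  by rewrite !eqxx (negPf va) (negPf vb) (negPf vc) (negPf ab) (negPf ac) (negPf bc).
have idx := (iv, ia, ib, ic).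
(* Colourings are read off symmetric tables indexed by [v], [a], [b], [c]. *)
pose entry (m : seq (seq nat)) x y := nth 0 (nth [::] m (index x P)) (index y P).
have nS (S' : rel T) x y : symmetric S' -> ~~ S' x y -> (S' x y = false) * (S' y x = false).
  by move=> symS' /negPf Sxy; rewrite -(symS' x y) Sxy.
have top_pair (rk : T -> T -> nat) (S' : rel T) x y : symmetric S' -> S' x y ->
    (forall z, S' x z -> rk x y <= rk x z) -> (forall z, S' y z -> rk y x <= rk y z) ->
    exists x y, top rk S' x y /\ top rk S' y x.
  move=> symS' Sxy hx hy; exists x, y.
  have Syx : S' y x by rewrite symS'.
  by split; apply/topP.
have [low|high] := leqP c0.*2 k.-1.
  have [d3 def_d3 lt_d3] : exists2 d3, d3 = k.-1 & c2 < d3.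
    by exists k.-1; rewrite // -ltnS prednK; [apply: leq_ltn_trans lt23 lt3 | apply: leq_ltn_trans lt3].
  have d3_lt : d3 < k by rewrite def_d3 prednK //; apply: leq_ltn_trans lt3.
  pose f := entry [:: [:: 0; c0; c1; c2]; [:: c0; 0; c2; c1];
                      [:: c1; c2; 0; d3]; [:: c2; c1; d3; 0]].
  pose s x := index x P < 2.
  have lts : [/\ c0 < k, c1 < k & c2 < k] by split; lia.
  have ne : ((c0 == c1) = false) * ((c0 == c2) = false) * ((c0 == d3) = false) *
    ((c1 == c2) = false) * ((c1 == d3) = false) * ((c2 == d3) = false).
    by do !split; apply/negbTE; rewrite neq_ltn; apply/orP; left; lia.
  have les : [/\ c0 <= c1, c0 <= c2, c0 <= d3, c1 <= d3 & c2 <= d3].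
    by split; lia.
  have prop : proper_colouring k (restrict W) f.
    case: lts => l0 l1 l2.
    split.
    - by move=> x y /and3P[_ /memW[]-> /memW[]->]; rewrite /f /entry !idx.
    - move=> x y /and3P[exy /memW xW /memW yW].
      by case: xW exy => ->; case: yW => ->; rewrite ?e_irr // /f /entry !idx.
    - move=> x y z /and3P[exy /memW xW /memW yW] /and3P[exz _ /memW zW] /eqP.
      by case: xW exy exz => ->; case: yW => ->; rewrite ?e_irr // => _;
         case: zW => ->; rewrite ?e_irr // /f /entry !idx /= ?ne // 1?eq_sym ?ne.
  exists s, f; split; last 2 first.
  - by rewrite /s iv.
  - move=> y /and3P[evy _ /memW yW].
    by case: yW evy => ->; rewrite ?e_irr // /f /entry !idx !inE eqxx ?orbT.
  split=> //.
    move=> x y /and3P[exy /memW xW /memW yW].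
    case: xW exy => ->; case: yW => ->; rewrite ?e_irr // /s /f /entry !idx //= => _ _;
    by rewrite def_d3 -addnn leq_addr.
  move=> S symS sub; apply: (stable_mutual_top (s := s)) => //.
    exact: strict_sub (strict_rank prop).
  move=> S' symS' subS.
  have subS' x y : S' x y -> [/\ e x y, x \in W & y \in W].
    by move=> /subS/sub/and3P[].
  case: les => l01 l02 l03 l13 l23.
  have [Sva|/(nS _ _ _ symS') nva] := boolP (S' v a).
    right; apply: (top_pair _ _ v a) => // z Sz; have [exz _ /memW zW] := subS' _ _ Sz;
    by case: zW exz => ->; rewrite ?e_irr // /rank /s /f /entry !idx.
  have [Sbc|/(nS _ _ _ symS') nbc] := boolP (S' b c).
    right; apply: (top_pair _ _ b c) => // z Sz; have [exz _ /memW zW] := subS' _ _ Sz;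
    by case: zW exz => ->; rewrite ?e_irr // /rank /s /f /entry !idx //= leq_sub2l.
  left=> x y Sxy; have [exy /memW xW /memW yW] := subS' _ _ Sxy.
  by case: xW exy Sxy => ->; case: yW => ->; rewrite ?e_irr ?nva ?nbc // /s !idx.
(* Every colour of [A] is now high, so [a], [b] and [c] may all lie in U. In the order [a c], [a b],
   [v a], [v b], [v c], [b c], the first edge still present is a first choice of both its ends. *)
pose f := entry [:: [:: 0; c0; c1; c2]; [:: c0; 0; c2; c3];
                    [:: c1; c2; 0; c0]; [:: c2; c3; c0; 0]].
pose s x := index x P == 0.
have lts : [/\ c0 < k, c1 < k & c2 < k] by split; lia.
have ne : ((c0 == c1) = false) * ((c0 == c2) = false) * ((c0 == c3) = false) *
    ((c1 == c2) = false) * ((c1 == c3) = false) * ((c2 == c3) = false).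
    by do !split; apply/negbTE; rewrite neq_ltn; apply/orP; left; lia.
have les : [/\ c0 <= c1, c0 <= c2, c0 <= c3, c1 <= c2 & c2 <= c3].
  by split; lia.
have prop : proper_colouring k (restrict W) f.
  case: lts => l0 l1 l2.
  split.
  - by move=> x y /and3P[_ /memW[]-> /memW[]->]; rewrite /f /entry !idx.
  - move=> x y /and3P[exy /memW xW /memW yW].
    by case: xW exy => ->; case: yW => ->; rewrite ?e_irr // /f /entry !idx.
  - move=> x y z /and3P[exy /memW xW /memW yW] /and3P[exz _ /memW zW] /eqP.
    by case: xW exy exz => ->; case: yW => ->; rewrite ?e_irr // => _;
       case: zW => ->; rewrite ?e_irr // /f /entry !idx /= ?ne // 1?eq_sym ?ne.
exists s, f; split; last 2 first.
- by rewrite /s iv.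
- move=> y /and3P[evy _ /memW yW].
  by case: yW evy => ->; rewrite ?e_irr // /f /entry !idx !inE eqxx ?orbT.
case: les => l01 l02 l03 l12 l23.
split=> //.
  move=> x y /and3P[exy /memW xW /memW yW].
  case: xW exy => ->; case: yW => ->; rewrite ?e_irr // /s /f /entry !idx //= => _ _;
  by apply: ltnW; apply: leq_trans high _; rewrite leq_double.
move=> S symS sub; apply: (stable_mutual_top (s := s)) => //.
  exact: strict_sub (strict_rank prop).
move=> S' symS' subS.
have subS' x y : S' x y -> [/\ e x y, x \in W & y \in W].
  by move=> /subS/sub/and3P[].
have [Sac|/(nS _ _ _ symS') nac] := boolP (S' a c).
  right; apply: (top_pair _ _ a c) => // z Sz; have [exz _ /memW zW] := subS' _ _ Sz;
  by case: zW exz => ->; rewrite ?e_irr // /rank /s /f /entry !idx //= leq_sub2l.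
have [Sab|/(nS _ _ _ symS') nab] := boolP (S' a b).
  right; apply: (top_pair _ _ a b) => // z Sz; have [exz _ /memW zW] := subS' _ _ Sz;
  by case: zW exz Sz => ->; rewrite ?e_irr ?nac // /rank /s /f /entry !idx //= leq_sub2l.
have [Sva|/(nS _ _ _ symS') nva] := boolP (S' v a).
  right; apply: (top_pair _ _ v a) => // z Sz; have [exz _ /memW zW] := subS' _ _ Sz;
  by case: zW exz Sz => ->; rewrite ?e_irr ?nac ?nab // /rank /s /f /entry !idx.
have [Svb|/(nS _ _ _ symS') nvb] := boolP (S' v b).
  right; apply: (top_pair _ _ v b) => // z Sz; have [exz _ /memW zW] := subS' _ _ Sz;
  by case: zW exz Sz => ->; rewrite ?e_irr ?nac ?nab ?nva // /rank /s /f /entry !idx //= leq_sub2l.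
have [Svc|/(nS _ _ _ symS') nvc] := boolP (S' v c).
  right; apply: (top_pair _ _ v c) => // z Sz; have [exz _ /memW zW] := subS' _ _ Sz;
  by case: zW exz Sz => ->; rewrite ?e_irr ?nac ?nab ?nva ?nvb // /rank /s /f /entry !idx //= leq_sub2l.
have [Sbc|/(nS _ _ _ symS') nbc] := boolP (S' b c).
  right; apply: (top_pair _ _ b c) => // z Sz; have [exz _ /memW zW] := subS' _ _ Sz;
  by case: zW exz Sz => ->; rewrite ?e_irr ?nac ?nab ?nva ?nvb ?nvc // /rank /s /f /entry !idx.
left=> x y Sxy; have [exy /memW xW /memW yW] := subS' _ _ Sxy.
by case: xW exy Sxy => ->; case: yW => ->; rewrite ?e_irr ?nac ?nab ?nva ?nvb ?nvc ?nbc.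
Qed.

End Rooted.

(** * Induction over separations *)

Section Induction.

Variables (T : finType) (e : rel T) (k : nat).
Hypotheses (e_sym : symmetric e) (e_irr : irreflexive e).
Hypothesis deg_e : forall x, #|[set y | e x y]| < k.
Hypothesis no_long_odd_cycle : forall c, ucycle e c -> odd (size c) -> size c < 5.

Local Notation restrict := (restrict e).

Lemma separation_dec (W : {set T}) :
  (exists C z, separation e W C z) \/ (forall C z, ~ separation e W C z).
Proof.
have sepP C z : reflect (separation e W C z)
    [&& C \subset W, z \in W :\: C, C != set0, z |: C != W
      & [forall x in C, forall y in W, e x y ==> (y \in C) || (y == z)]].
  apply: (iffP and5P) => -[CW zW C0 neqW sep]; split=> //.
    move=> x y xC yW exy; move/forall_inP/(_ _ xC)/forall_inP/(_ _ yW): sep.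
    by rewrite exy => /orP[|/eqP]; [left|right].
  apply/forall_inP=> x xC; apply/forall_inP=> y yW; apply/implyP=> exy.
  by case: (sep x y xC yW exy) => [->|->]; rewrite ?eqxx ?orbT.
have [/existsP[C /existsP[z /sepP sep]]|nosep] :=
  boolP [exists C : {set T}, exists z, [&& C \subset W, z \in W :\: C, C != set0, z |: C != W
      & [forall x in C, forall y in W, e x y ==> (y \in C) || (y == z)]]].
  by left; exists C, z.
right=> C z /sepP sep; case/negP: nosep; apply/existsP; exists C.
by apply/existsP; exists z.
Qed.

(** Odd cycles are shorter than 5 and loops are excluded, so an odd cycle could only be a
    triangle. *)
Lemma triangle_free_bipartite (W : {set T}) :
    (forall a b c, a \in W -> b \in W -> c \in W -> e a b -> e b c -> ~~ e a c) ->
  exists s : T -> bool, forall x y, restrict W x y -> s x != s y.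
Proof.
move=> notri; apply: no_odd_cycle_bipartite.
  exact: restrict_sym.
move=> c /andP[cyc uc]; apply/negP => odd_c.
have lt5 : size c < 5.
  apply: no_long_odd_cycle odd_c; rewrite /ucycle uc andbT.
  by apply: sub_cycle cyc => x y /and3P[].
case: c cyc uc odd_c lt5 => [|x [|y [|z [|t [|]]]]] //=.
  by rewrite restrict_irr.
move=> /and4P[/and3P[exy xW yW] /and3P[eyz _ zW] /and3P[ezx _ _] _] _ _ _.
by have := notri x y z xW yW zW exy eyz; rewrite e_sym ezx.
Qed.

(** Induction on the size of [W] replaces the block decomposition: a separation splits [W] into two
    smaller sets that share only [z]. *)
Lemma rooted_all (W : {set T}) v b : v \in W -> rooted e k W v b.
Proof.
have [n] := ubnP #|W|; elim: n W v b => // n IHn W v b le_n vW.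
have [[C [z [CW /setDP[zW zC] C0 neqW sep]]]|nosep] := separation_dec W.
  have zX : z \in z |: C by rewrite setU11.
  have zY : z \in W :\: C by rewrite inE zC.
  have XY x : x \in z |: C -> x \in W :\: C -> x = z.
    by rewrite !inE => /predU1P[//|->].
  have eqW : (z |: C) :|: (W :\: C) = W.
    apply/setP=> x; rewrite !inE; have [->|_] /= := eqVneq x z; first by rewrite zW.
    by case xC: (x \in C) => //=; rewrite (subsetP CW).
  have eqr x y : restrict ((z |: C) :|: (W :\: C)) x y =
                 restrict (z |: C) x y || restrict (W :\: C) x y.
    rewrite eqW /restrict; apply/idP/idP; last first.
      case/orP=> /and3P[->] /=; last by move=> /setDP[-> _] /setDP[].
      have XW : z |: C \subset W by rewrite subUset sub1set zW.
      by move=> /(subsetP XW)-> /(subsetP XW).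
    case/and3P=> exy xW yW; rewrite exy !inE xW yW /= !andbT.
    have [xC|nxC] := boolP (x \in C); have [yC|nyC] := boolP (y \in C);
      rewrite ?orbT ?orbF //=.
      by case: (sep _ _ xC yW exy) => [|->]; [rewrite (negPf nyC)|rewrite eqxx].
    by rewrite e_sym in exy; case: (sep _ _ yC xW exy) => [|->];
       [rewrite (negPf nxC)|rewrite eqxx].
  have rX u c : u \in z |: C -> rooted e k (z |: C) u c.
    apply: IHn; apply: leq_trans (proper_card _) (le_n : #|W| <= n); rewrite properEneq neqW.
    by rewrite subUset sub1set zW.
  have rY u c : u \in W :\: C -> rooted e k (W :\: C) u c.
    apply: IHn; apply: leq_trans (proper_card _) (le_n : #|W| <= n); rewrite properEneq subsetDl andbT.
    apply: contraNneq C0 => eqWC; rewrite -subset0; apply/subsetP => x xC.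
    by have := subsetP CW _ xC; rewrite -eqWC inE xC.
  (* The part that contains the root is coloured first, and the other part is rooted at [z]. *)
  rewrite -eqW; have [vX|vX] := boolP (v \in z |: C).
    by apply: (rooted_glue e_sym e_irr deg_e XY) => // [|b']; [apply: rX|apply: rY].
  have vY : v \in W :\: C by move: vX; rewrite !inE negb_or vW => /andP[_ ->].
  rewrite setUC; apply: (rooted_glue (z := z) e_sym e_irr deg_e) => //.
  - by move=> x xY xX; apply: XY.
  - by move=> x y; rewrite setUC eqr orbC.
  - exact: rY.
  - by move=> b'; apply: rX.
have [/existsP[a /existsP[c /existsP[d /and5P[aW cW dW eac /andP[ecd ead]]]]]|notri] :=
  boolP [exists a, exists c, exists d,
    [&& a \in W, c \in W, d \in W, e a c & e c d && e a d]]; last first.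
  have [|s0 bip] := @triangle_free_bipartite W; last exact: rooted_bipartite bip.
  move=> a c d aW cW dW eac ecd; apply: contraNN notri => ead.
  apply/existsP; exists a; apply/existsP; exists c; apply/existsP; exists d.
  by rewrite aW cW dW eac ecd.
suff rt : rooted e k W v true by case: b => //; apply: rooted_flip.
have [[a' [b' bk]]|K4] := nonseparable_triangle e_sym e_irr no_long_odd_cycle
                            aW cW dW eac ecd ead nosep; last exact: rooted_complete4.
have [->|nva] := eqVneq v a'; first exact: rooted_spine bk.
have [->|nvb] := eqVneq v b'; first exact: rooted_spine (book_swap _ bk).
exact: rooted_page bk _ _ _.
Qed.

Lemma good_exists : exists s f, good k e s f.
Proof.
have eqT : restrict setT =2 e by move=> x y; rewrite /restrict !inE !andbT.
have [|noT] := pickP T => [v _|].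
  have [||||s [f [gd _ _]]] := @rooted_all setT v true _ (iota 0 k).
  - by rewrite inE.
  - exact: iota_ltn_sorted.
  - by move=> c; rewrite mem_iota.
  - by rewrite size_iota nbrs_lt.
  exists s, f; apply: good_ext gd => //; exact: restrict_sym.
(* Without vertices there is no root to start from, and all conditions are vacuous. *)
exists (fun _ => true), (fun _ _ => 0).
split; [split=> x; by have := noT x|by move=> x; have := noT x|].
by move=> S _ _; exists S; split=> // x; have := noT x.
Qed.

End Induction.

(** * From good colourings to proper Galvin orientations *)

Section GalvinOrientation.

Variables (T : finType) (e : rel T) (k : nat) (s : T -> bool) (f : T -> T -> nat).
Hypotheses (e_sym : symmetric e) (gd : good k e s f).
Implicit Types a b : edge e.

Lemma edgeP a : exists x y, e x y /\ val a = [set x; y].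
Proof.
case: a => A /=; rewrite inE => /existsP[x /existsP[y /andP[exy /eqP->]]].
by exists x, y.
Qed.

Lemma other_end a x : x \in val a -> exists2 y, e x y & val a = [set x; y].
Proof.
have [u [w [euw ->]]] := edgeP a; rewrite !inE => /orP[] /eqP->; first by exists w.
by exists u; rewrite 1?e_sym // setUC.
Qed.

(** Edges are unordered pairs while [f] takes ordered ones; either order may be picked, as [f] is
    symmetric on edges. The default 0 is never reached. *)
Definition edge_value a : nat :=
  if [pick p : T * T | e p.1 p.2 && (val a == [set p.1; p.2])] is Some p
  then f p.1 p.2 else 0.

Lemma edge_valueE a x y : e x y -> val a = [set x; y] -> edge_value a = f x y.
Proof.
have [[symf _ _] _ _] := gd.
move=> exy va; rewrite /edge_value; case: pickP => [[u w] /=|/(_ (x, y))]; last first.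
  by rewrite /= exy va eqxx.
case/andP=> euw /eqP; rewrite va => eqxy.
have hu : u \in [set x; y] by rewrite eqxy set21.
have hw : w \in [set x; y] by rewrite eqxy set22.
have hx : x \in [set u; w] by rewrite -eqxy set21.
have hy : y \in [set u; w] by rewrite -eqxy set22.
move: hu hw hx hy; rewrite !inE => /orP[] /eqP eu /orP[] /eqP ew.
- by rewrite eu ew !orbb => _ /eqP->.
- by rewrite eu ew.
- by rewrite eu ew symf // e_sym.
- by rewrite eu ew !orbb => /eqP->.
Qed.

Lemma edge_value_lt a : edge_value a < k.
Proof.
have [[_ ltf _] _ _] := gd; have [x [y [exy va]]] := edgeP a.
by rewrite (edge_valueE exy va) ltf.
Qed.

Definition edge_phi : {ffun edge e -> 'I_k} := [ffun a => Ordinal (edge_value_lt a)].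

Lemma edge_phiE a x y : e x y -> val a = [set x; y] -> edge_phi a = f x y :> nat.
Proof. by move=> exy va; rewrite ffunE /= (edge_valueE exy va). Qed.

Lemma edge_phi_proper : edge_colouring edge_phi.
Proof.
have [[_ _ strf] _ _] := gd.
move=> x a b /and3P[nab /other_end[y exy va] /other_end[z exz vb]].
apply: contraNneq nab => eq_phi; apply/eqP/val_inj.
rewrite va vb; congr [set x; _]; apply: (strf x) => //.
by rewrite -(edge_phiE exy va) -(edge_phiE exz vb) eq_phi.
Qed.

Let D := [set x | s x].
Let U := [set x | ~~ s x].

Lemma galvin_arcE x a b : galvin_arc U D edge_phi x a b =
  line_edge x a b && (if s x then edge_phi b < edge_phi a else edge_phi a < edge_phi b).
Proof. by rewrite /galvin_arc !inE; case: (s x); rewrite /= ?orbF. Qed.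

Lemma galvin_arc_rank x y z a b :
    e x y -> val a = [set x; y] -> e x z -> val b = [set x; z] ->
    rank k s f x z < rank k s f x y ->
  galvin_arc U D edge_phi x a b.
Proof.
have [[_ ltf _] _ _] := gd.
move=> exy va exz vb lt.
have lt' : if s x then edge_phi b < edge_phi a else edge_phi a < edge_phi b.
  rewrite (edge_phiE exy va) (edge_phiE exz vb).
  have := ltf _ _ exy; have := ltf _ _ exz.
  by move: lt; rewrite /rank; case: (s x); lia.
rewrite galvin_arcE lt' andbT /line_edge va vb !set21 !andbT.
by apply: contraTneq lt' => ->; case: (s x); rewrite ltnn.
Qed.

(** The edges in [S] form a subgraph [R], and a stable matching of [R] is a kernel: matching edges
    share no end, and a content end of an unmatched edge supplies an arc into the matching. *)
Lemma galvin_kernel_perfect : kernel_perfect (galvin_arc U D edge_phi).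
Proof.
have [prop _ sol] := gd; move=> S.
pose R x y := e x y && [exists a in S, val a == [set x; y]].
have symR : symmetric R by move=> x y; rewrite /R e_sym setUC.
have [|M [subM symM matM con]] := sol R symR; first by move=> x y /andP[].
pose K := [set a in S | [exists x, exists y, M x y && (val a == [set x; y])]].
have KP a x : a \in K -> x \in val a -> exists2 y, M x y & val a = [set x; y].
  rewrite inE => /andP[_ /existsP[u /existsP[w /andP[Muw /eqP->]]]].
  by rewrite !inE => /orP[] /eqP->; [exists w | exists u; rewrite 1?symM // setUC].
have inK a x y : a \in S -> M x y -> val a = [set x; y] -> a \in K.
  move=> aS Mxy va; rewrite inE aS; apply/existsP; exists x; apply/existsP; exists y.
  by rewrite Mxy va eqxx.
exists K; split.
- by apply/subsetP=> a; rewrite inE => /andP[].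
- move=> x a b aK bK; apply/negP; rewrite galvin_arcE => /andP[/and3P[nab xa xb] _].
  have [y Mxy va] := KP _ _ aK xa; have [z Mxz vb] := KP _ _ bK xb.
  by case/eqP: nab; apply: val_inj; rewrite va vb (matM _ _ _ Mxy Mxz).
move=> a /setDP[aS aK].
have dom x y : e x y -> val a = [set x; y] -> content (rank k s f) M x y ->
    exists (i : T) b, b \in K /\ galvin_arc U D edge_phi i a b.
  move=> exy va [z Mxz le]; have /andP[exz /exists_inP[b bS /eqP vb]] := subM _ _ Mxz.
  exists x, b; split; first exact: inK Mxz vb.
  (* An arc needs a strict inequality: equal ranks would identify [z] with [y] and put [a] in the
     kernel. *)
  apply: (galvin_arc_rank exy va exz vb); rewrite ltn_neqAle le andbT.
  apply: contraNneq aK => /(strict_rank prop exz exy) zy.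
  by apply: (inK a x y) => //; rewrite -zy.
have [x [y [exy va]]] := edgeP a.
have Rxy : R x y by rewrite /R exy; apply/exists_inP; exists a; rewrite ?va.
case: (con x y Rxy) => [/(dom _ _ exy va)//|]; apply: dom; first by rewrite e_sym.
by rewrite setUC.
Qed.

(** The out-neighbours of [a] at [x] have distinct colours, all smaller than that of [a] in D and
    all larger in U. *)
Lemma card_out_at x a : #|[set b | galvin_arc U D edge_phi x a b]| <=
  if s x then edge_phi a : nat else k.-1 - edge_phi a.
Proof.
set B := [set b | _].
have uB : uniq [seq nat_of_ord (edge_phi b) | b <- enum B].
  rewrite map_inj_in_uniq ?enum_uniq // => b c; rewrite !mem_enum !inE !galvin_arcE.
  move=> /andP[/and3P[_ _ xb] _] /andP[/and3P[_ _ xc] _] /val_inj eq_bc; apply/eqP.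
  apply: contraT => nbc; have := @edge_phi_proper x b c.
  by rewrite /line_edge nbc xb xc eq_bc eqxx => /(_ isT).
have bound r : {subset [seq nat_of_ord (edge_phi b) | b <- enum B] <= r} ->
    #|B| <= size r.
  by move/(uniq_leq_size uB); rewrite size_map -cardE.
case sx: (s x).
  rewrite -[X in _ <= X](size_iota 0); apply: bound => c /mapP[b + ->].
  by rewrite mem_enum inE galvin_arcE sx mem_iota => /andP[].
rewrite -[X in _ <= X](size_iota (edge_phi a).+1); apply: bound => c /mapP[b + ->].
rewrite mem_enum inE galvin_arcE sx mem_iota => /andP[_ lt].
rewrite lt /=; move: lt (ltn_ord (edge_phi b)).
by move: (nat_of_ord _) (nat_of_ord _) => i j; clear; lia.
Qed.

(** If [a] has colour j, its two ends contribute at most 2j inside D, 2(k-1-j) inside U, and j +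
    (k-1-j) = k-1 across; [good] bounds the first two by k-1. *)
Lemma galvin_outdegree a : outdegree (galvin_arc U D edge_phi) a <= k - 1.
Proof.
have [_ mono _] := gd; have [x [y [exy va]]] := edgeP a.
pose B z := [set b | galvin_arc U D edge_phi z a b].
have sub : [set p : T * edge e | galvin_arc U D edge_phi p.1 a p.2] \subset
    [set (x, b) | b in B x] :|: [set (y, b) | b in B y].
  apply/subsetP=> -[z b]; rewrite inE /= => arc_ab.
  have : z \in val a by move: arc_ab; rewrite galvin_arcE => /andP[/and3P[]].
  rewrite va !inE => /orP[] /eqP ez; rewrite ez in arc_ab *; apply/orP; [left|right];
  by apply/imsetP; exists b; rewrite ?inE.
apply: leq_trans (subset_leq_card sub) _; apply: leq_trans (leq_card_setU _ _) _.
apply: leq_trans (leq_add (leq_imset_card _ _) (leq_imset_card _ _)) _.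
apply: leq_trans (leq_add (card_out_at x a) (card_out_at y a)) _.
have := mono _ _ exy; rewrite -(edge_phiE exy va); have := ltn_ord (edge_phi a).
move: (nat_of_ord (edge_phi a)) => j; clear; rewrite -addnn subn1.
by case: (s x) (s y) => [] [] /= lt; [move/(_ erefl)|move=> _|move=> _|move/(_ erefl)];
  lia.
Qed.

Lemma good_galvin : has_proper_galvin e k.
Proof.
exists U, D, edge_phi; split.
- by apply/setP=> x; rewrite !inE; case: (s x).
- by apply/setP=> x; rewrite !inE; case: (s x).
- exact: edge_phi_proper.
- by split; [apply: galvin_kernel_perfect | apply: galvin_outdegree].
Qed.

End GalvinOrientation.

Theorem theorem8 (T : finType) (e : rel T)
    (e_sym : symmetric e) (e_irr : irreflexive e)
    (no_long_odd_cycle :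
       ~ exists c : seq T, [/\ ucycle e c, odd (size c) & 5 <= size c]) :
  has_proper_galvin e (max_degree e + 1).
Proof.
have deg x : #|[set y | e x y]| < max_degree e + 1.
  by rewrite addn1 ltnS; apply: (leq_bigmax x).
have short c : ucycle e c -> odd (size c) -> size c < 5.
  move=> uc odd_c; rewrite ltnNge; apply/negP => le5.
  by case: no_long_odd_cycle; exists c.
have [s [f gd]] := good_exists e_sym e_irr deg short.
exact: good_galvin e_sym gd.
Qed.
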